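(* Let $\varrho\colon \mathcal M_+(0,\infty)\to[0,\infty]$ be a sub-monotone functional, let $p\in(1,\infty)$, let $v$ be a weight on $(0,\infty)$ with $V(t)=\int_0^t v(s)\,ds<\infty$ for every $t\in(0,\infty)$, and let $\varphi\colon(0,\infty)\to(-\infty,\infty)$ be a fixed function that is either concave and strictly increasing, or convex and strictly decreasing. Then the following statements are equivalent: (i) There exists a positive constant $C_1$ such that $$\varrho\left(\frac{1}{V(t)}\int_{0}^{t}f(s)v(s)\,ds\right)\le C_1\left(\int_{0}^{\infty}f(t)^{p}v(t)\,dt\right)^{\frac1p}$$ for every $f\in\mathcal M_+(0,\infty)$. (ii) For every $r\in[1,\infty)$ and every $\alpha\in(\max\{-\frac1p,-\frac1{p'}\},\infty)$ there exist positive constants $C_{2,1}$ and $C_{2,2}$ such that $$\varrho\left(V(t)^{\alpha}\left(\int_{t}^{\infty}f(s)\frac{v(s)}{V(s)}\,ds\right)^{\frac rp}\right)\le C_{2,1}\left(\int_{0}^{\infty}f(t)^{r}V(t)^{\alpha p}v(t)\,dt\right)^{\frac1p}$$ for every $f\in\mathcal M_+(0,\infty)$, and $$\varrho(\boldsymbol 1)\le C_{2,2}\left(\int_0^\infty v(t)\,dt\right)^{\frac1p}.$$ (iii) There exist $r\in[1,\infty)$, $\alpha\in(\max\{-\frac1p,-\frac1{p'}\},\infty)$, and positive constants $C_3$ and $C_{2,2}$ such that $$\varrho\left(V(t)^{\alpha}\left(\int_{t}^{\infty}f(s)\frac{v(s)}{V(s)}\,ds\right)^{\frac rp}\right)\le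 C_{3}\left(\int_{0}^{\infty}f(t)^{r}V(t)^{\alpha p}v(t)\,dt\right)^{\frac1p}$$ for every $f\in\mathcal M_+(0,\infty)$, and $$\varrho(\boldsymbol 1)\le C_{2,2}\left(\int_0^\infty v(t)\,dt\right)^{\frac1p}.$$ (iv) For every triple $(r,\alpha,\beta)$ satisfying $r\in[1,\infty)$, $\alpha\in(\max\{-\frac1p,-\frac1{p'}\},\infty)$, $\beta\in(-\frac1{r'},\infty)$ and $\alpha p-\beta r<r-1$, there exists a positive constant $C_4$ such that $$\varrho\left(\left(\frac{1}{V(t)}\int_{0}^{t}f(s)v(s)\,ds\right)^{\frac rp}V(t)^{\alpha-\frac{\beta r}{p}}\right)\le C_4\left(\int_{0}^{\infty}f(t)^{r}V(t)^{\alpha p-\beta r}v(t)\,dt\right)^{\frac1p}$$ for every $f\in\mathcal M_+(0,\infty)$. (v) There exist a triple $(r,\alpha,\beta)$ satisfying $r\in[1,\infty)$, $\alpha\in(\max\{-\frac1p,-\frac1{p'}\},\infty)$, $\beta\in(-\frac1{r'},\infty)$ and $\alpha p-\beta r<r-1$, and a positive constant $C_5$ such that $$\varrho\left(\left(\frac{1}{V(t)}\int_{0}^{t}f(s)v(s)\,ds\right)^{\frac rp}V(t)^{\alpha-\frac{\beta r}{p}}\right)\le C_5\left(\int_{0}^{\infty}f(t)^{r}V(t)^{\alpha p-\beta r}v(t)\,dt\right)^{\frac1p}$$ for every $f\in\mathcal M_+(0,\infty)$. (vi) There exists a positive constant $C_6$ such that $$\varrho\left(\exp\left(\frac{1}{V(t)}\int_{0}^{t}\log(f(s))v(s)\,ds\right)\right)\le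 C_6\left(\int_{0}^{\infty}f(t)^{p}v(t)\,dt\right)^{\frac1p}$$ for every measurable strictly positive function $f$ on $(0,\infty)$. (vii) For every $r\in(0,\infty)$ there exists a positive constant $C_7$ such that $$\varrho\left(\left(\frac{V(t)}{\int_{0}^{t}f(s)^{-1}v(s)\,ds}\right)^{r}\right)\le C_7\left(\int_{0}^{\infty}f(t)^{rp}v(t)\,dt\right)^{\frac1p}$$ for every measurable strictly positive function $f$ on $(0,\infty)$. (viii) There exist $r\in(0,\infty)$ and a positive constant $C_8$ such that $$\varrho\left(\left(\frac{V(t)}{\int_{0}^{t}f(s)^{-1}v(s)\,ds}\right)^{r}\right)\le C_8\left(\int_{0}^{\infty}f(t)^{rp}v(t)\,dt\right)^{\frac1p}$$ for every measurable strictly positive function $f$ on $(0,\infty)$. (ix) There exists a positive constant $C_9$ such that $$\varrho\left(\varphi^{-1}\left(\frac{1}{V(t)}\int_{0}^{t}\varphi(f(s))v(s)\,ds\right)\right)\le C_9\left(\int_{0}^{\infty}f(t)^{p}v(t)\,dt\right)^{\frac1p}$$ for every measurable strictly positive function $f$ on $(0,\infty)$.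
   Context: $\mathcal M_+(0,\infty)$ is the collection of all measurable functions on $(0,\infty)$ with values in $[0,\infty]$, and $\boldsymbol 1=\chi_{(0,\infty)}$ is the constant function $1$. A functional $\varrho\colon\mathcal M_+(0,\infty)\to[0,\infty]$ is called sub-monotone if $\varrho(f)\le\varrho(g)$ for all $f,g\in\mathcal M_+(0,\infty)$ with $f\le g$, and there exists a positive constant $K$ such that both of the following hold: (a) if $\varrho(\boldsymbol 1)<\infty$, then $\varrho(f+\boldsymbol 1)\le K(\varrho(f)+\varrho(\boldsymbol 1))$ for every $f\in\mathcal M_+(0,\infty)$; (b) $\varrho(\lambda f)\le K\lambda\varrho(f)$ for every $\lambda\ge0$ and $f\in\mathcal M_+(0,\infty)$. A weight is a measurable and almost everywhere strictly positive function on $(0,\infty)$. For $q\in[1,\infty)$, $q'$ denotes the conjugate exponent, i.e. $\frac1{q'}=1-\frac1q$ (so $\frac1{q'}=0$ for $q=1$). An expression in the variable $t$ inside $\varrho(\cdot)$ denotes the function of $t\in(0,\infty)$ given by that expression. Conventions: expressions such as $0\cdot\infty$, $\frac00$, $\frac\infty\infty$, $\exp(\log(0))$ etc. are treated as zero. In particular $\exp(-\infty)=0$, and likewise $\varphi^{-1}$ of an infinite average is taken to be $0$ when $\varphi(0+)$ equals that infinite value (i.e. $\varphi^{-1}(-\infty)=0$ if $\varphi$ is increasing with $\varphi(0+)=-\infty$, and $\varphi^{-1}(+\infty)=0$ if $\varphi$ is decreasing with $\varphi(0+)=+\infty$). An inequality whose right-hand side is infinite is regarded as trivially satisfied. *)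

(* Defs.v *)
From HB Require Import structures.
From mathcomp Require Import all_boot all_order all_algebra.
From mathcomp Require Import all_classical all_reals all_analysis.
From mathcomp Require Import measurable_realfun.
Import Order.TTheory GRing.Theory Num.Theory numFieldNormedType.Exports.

Set Implicit Arguments.
Unset Strict Implicit.
Unset Printing Implicit Defensive.

Local Open Scope classical_set_scope.
Local Open Scope ring_scope.

(* Functions on (0, +oo) are represented by functions on the whole line, of
   which only the restriction to `]0, +oo[ is ever constrained or used.
   Measurability is with respect to the Borel sets, on which
   [lebesgue_measure] is defined. *)

Definition Mplus (R : realType) (f : R -> \bar R) : Prop :=
  measurable_fun (`]0, +oo[ : set R) f /\ forall t, 0 < t -> (0 <= f t)%E.

Definition positive_mfun (R : realType) (f : R -> R) : Prop :=
  measurable_fun (`]0, +oo[ : set R) f /\ forall t, 0 < t -> 0 < f t.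

(* Monotonicity is for the pointwise order on (0, +oo); applied to functions
   agreeing there, it forces [rho f] to depend only on [f] on (0, +oo). *)
Definition submonotone (R : realType) (rho : (R -> \bar R) -> \bar R) : Prop :=
  (forall f g, Mplus f -> Mplus g ->
     (forall t, 0 < t -> (f t <= g t)%E) -> (rho f <= rho g)%E) /\
  exists K : R,
    [/\ 0 < K,
        ((rho (fun=> 1) < +oo)%E -> forall f, Mplus f ->
           (rho (fun t => f t + 1) <= K%:E * (rho f + rho (fun=> 1)))%E) &
        (forall (l : R) f, 0 <= l -> Mplus f ->
           (rho (fun t => l%:E * f t) <= K%:E * l%:E * rho f)%E)].

Definition weight (R : realType) (v : R -> \bar R) : Prop :=
  measurable_fun (`]0, +oo[ : set R) v /\
  {ae @lebesgue_measure R, forall t, 0 < t -> (0 < v t)%E}.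

(* V(t) *)
Definition primitive (R : realType) (v : R -> \bar R) (t : R) : \bar R :=
  (\int[@lebesgue_measure R]_(s in `]0%R, t[) v s)%E.

(* 1/V(t) * \int_0^t g v; for signed g the value may be infinite *)
Definition average (R : realType) (v g : R -> \bar R) (t : R) : \bar R :=
  ((primitive v t)^-1 *
   \int[@lebesgue_measure R]_(s in `]0%R, t[) (g s * v s))%E.

(* \int_t^oo f v / V *)
Definition tail (R : realType) (v f : R -> \bar R) (t : R) : \bar R :=
  (\int[@lebesgue_measure R]_(s in `]t, +oo[) (f s * (v s / primitive v s)))%E.

(* 1/q', equal to 0 for q = 1 *)
Definition inv_conj (R : realType) (q : R) : R := 1 - q^-1.

Definition admissible (R : realType) (phi : R -> R) : Prop :=
  (@convex_function R R^o `]0, +oo[ (\- phi) /\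
   {in `]0, +oo[%R &, {homo phi : x y / x < y}}) \/
  (@convex_function R R^o `]0, +oo[ phi /\
   {in `]0, +oo[%R &, {homo phi : x y /~ x < y}}).

(* The inverse of phi : (0, +oo) -> R, set to 0 at infinite values. By
   Jensen's inequality, when the right-hand side of the inequality containing
   phi^-1 is finite, the average of phi o f is either in the range of phi or
   equal to the infinite value phi(0+); the junk values taken outside these
   cases are therefore irrelevant. *)
Definition einverse (R : realType) (phi : R -> R) (y : \bar R) : \bar R :=
  if y is r%:E then ('pinv_(fun=> 0) `]0, +oo[ phi r)%:E else 0%E.

(* Main.v *)
Require Import Defs.
From HB Require Import structures.
From mathcomp Require Import all_boot all_order all_algebra.
From mathcomp Require Import all_classical all_reals all_analysis.
From mathcomp Require Import measurable_realfun ring lra.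
Import Order.TTheory GRing.Theory Num.Theory numFieldNormedType.Exports.

(** All nine statements are equivalent to a single inequality in which no
integral operator occurs: for some constant C,

  rho g <= C (int g^p v)^(1/p)   for every nonincreasing g >= 0 on (0, oo).

Write [nu] for the measure v dt, so that V(t) = nu (0, t). Only three
properties of [nu] matter: it is finite and positive on every interval (0, t),
and it has no atoms.

Deriving an operator inequality from the inequality for nonincreasing
functions ([majorant_bound]): it suffices to find a nonincreasing majorant G
of the function T f inside rho with norm of G at most a constant times the
norm of f. For weighted averages ([average_bound]) one takes
G(t) = int max(V(t), V(s))^(gam - 1) f(s) dnu(s), nonincreasing since gam < 1;
for tails ([tail_bound]) the tail itself after moving the positive powers of V
under the integral. In both cases the norm estimate is an instance of a Hardy
inequality ([hardy]) for kernels homogeneous of degree -1 in V, obtained from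
a Schur test ([schur_test]) with the classical weight V^(1/r); the integrals
of powers of V which it requires come from a dyadic decomposition
([dyadic_integral_le]). For the exponential-logarithmic, harmonic and
phi-means no majorant is needed: by Jensen's inequality ([jensen]) they are
dominated by the plain average.

Conversely, given a nonincreasing g, one applies the operator inequality to an
f built from g such that c g <= T f, and uses that rho is monotone and
homogeneous up to a constant. An average or mean of a nonincreasing function
over (0, t) is at least its value at t, which settles these cases
([decreasing_bound_of_average], [decreasing_bound_of_qmean]). For tails
([decreasing_bound_of_tail]) the function f is an average of g with extra
weight near t, and c g <= T f holds only while 2 V(t) <= V(oo). When V(oo) is
finite, g is bounded on the remaining part by a constant comparable to
(V(oo)^-1 int g^p v)^(1/p); this is where the estimate of rho on f + 1 and the
bound on rho 1 enter.

The three kinds of means are treated at once: each is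
psi^-1 (average of psi o f), with psi equal to ln, to - x^(-1/r) (applied to
f^r), or to phi or - phi. The only property of psi which is used is that it is
strictly increasing with a supporting line from above at every point
([supported]); this gives Jensen's inequality as well as the continuity needed
to invert psi. *)

Set Implicit Arguments.
Unset Strict Implicit.
Unset Printing Implicit Defensive.

Local Open Scope classical_set_scope.
Local Open Scope ring_scope.

(** * A Schur test *)

Lemma powR_addr (R : realType) (x a b : R) :
  0 < x -> x `^ (a + b) = x `^ a * x `^ b.
Proof. by move=> x0; rewrite powRD// (gt_eqF x0) implybT. Qed.

Lemma powR_subr (R : realType) (x a b : R) :
  0 < x -> x `^ (a - b) = x `^ a / x `^ b.
Proof. by move=> x0; rewrite powR_addr// powRN. Qed.

(** A substitute for the inequality of Hoelder: it is integrated and then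
optimized in [c], which yields the power-mean inequality up to a constant,
uniformly in r >= 1 and without excluding infinite values. *)
Lemma le_add_poweR (R : realType) (c r : R) (x : \bar R) :
  0 < c -> 1 <= r -> (0 <= x)%E -> (x <= c%:E + (c `^ (1 - r))%:E * x `^ r)%E.
Proof.
move=> c0 r1; have cr0 : 0 < c `^ (1 - r) by exact: powR_gt0.
case: x => [x|_|//].
  rewrite lee_fin => x0; rewrite poweR_EFin -EFinM -EFinD lee_fin.
  have [xc|cx] := leP x c.
    by rewrite (le_trans xc)// lerDl mulr_ge0 ?powR_ge0.
  have x0' : 0 < x by exact: lt_trans cx.
  apply: (@le_trans _ _ (c `^ (1 - r) * x `^ r)); last by rewrite lerDr ltW.
  rewrite -{1}(powRr1 (ltW x0')) -[X in x `^ X <= _](subrK r) powR_addr//.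
  rewrite ler_wpM2r ?powR_ge0// -opprB !powRN lef_pV2 ?posrE ?powR_gt0//.
  by rewrite ge0_ler_powR ?nnegrE ?(ltW c0) ?(ltW x0') ?(ltW cx)// subr_ge0.
by rewrite poweRyr ?gt_eqF ?(lt_le_trans _ r1)// gt0_muley ?lte_fin// addey.
Qed.

Lemma le0_of_small_multiples (R : realType) (x : \bar R) (A : R) :
  0 <= A -> (forall c : R, 0 < c -> (x <= (c * A)%:E)%E) -> (x <= 0)%E.
Proof.
move=> A0 H; apply/lee_addgt0Pr => e e0; rewrite add0e.
have A1 : 0 < A + 1 by rewrite ltr_wpDl.
have /le_trans := H (e / (A + 1)) (divr_gt0 e0 A1); apply.
by rewrite lee_fin mulrAC ler_pdivrMr// ler_pM2l// lerDl.
Qed.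

(* optimisation in c *)
(** Optimizing the previous inequality once integrated: [A / q] stands for the
total mass of a kernel and [I] for the integral of the r-th power. *)
Lemma poweR_optimize (R : realType) (r A q : R) (x I : \bar R) :
  1 <= r -> 0 <= A -> 0 < q -> (0 <= x)%E -> (0 <= I)%E ->
  (forall c, 0 < c -> (x <= (c * (A * q^-1))%:E + (c `^ (1 - r))%:E * I)%E) ->
  (x `^ r <= ((A + 1) `^ r * q `^ (1 - r))%:E * I)%E.
Proof.
move=> r1 A0 q0 x0 I0 H.
have r0 : 0 < r by apply: lt_le_trans r1.
have A10 : 0 < A + 1 by rewrite ltr_wpDl.
case: I I0 H => [I|_ _|//]; last first.
  by rewrite gt0_muley ?leey// lte_fin mulr_gt0// powR_gt0.
rewrite lee_fin le_eqVlt => /predU1P[<- H|I0 H].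
  have /eqP : x = 0%E.
    apply/eqP; rewrite eq_le x0 andbT; apply: (@le0_of_small_multiples _ _ (A * q^-1)).
      by rewrite mulr_ge0// invr_ge0 ltW.
    by move=> c /H; rewrite mule0 adde0.
  by move=> /eqP ->; rewrite mule0 poweR0r ?gt_eqF.
(* this choice makes both terms of the bound multiples of c / q *)
set c := (I * q) `^ r^-1.
have Iq0 : 0 < I * q by rewrite mulr_gt0.
have c0 : 0 < c by rewrite powR_gt0.
have := H _ c0; rewrite -EFinM -EFinD.
have -> : c * (A / q) + c `^ (1 - r) * I = (A + 1) * (c / q).
  rewrite mulrDl mul1r mulrCA; congr (_ + _).
  rewrite powR_subr//.
  rewrite powRr1 ?(ltW c0)// -[c `^ r]powRrM mulVf ?gt_eqF// powRr1 ?(ltW Iq0)//.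
  by rewrite invfM -!mulrA; congr (_ * _); rewrite mulrCA mulVf ?gt_eqF// mulr1.
move=> xle.
have /le_trans : (x `^ r <= (((A + 1) * (c / q)) `^ r)%:E)%E.
  rewrite -poweR_EFin gt0_ler_poweR ?(ltW r0)//.
  - by rewrite in_itv/= x0 leey.
  - by rewrite in_itv/= leey lee_fin mulr_ge0 ?divr_ge0// ltW.
apply; rewrite -EFinM lee_fin.
rewrite powRM ?divr_ge0 ?(ltW A10) ?(ltW c0) ?(ltW q0)//.
rewrite powRM ?invr_ge0 ?(ltW c0) ?(ltW q0)//.
rewrite -[c `^ r]powRrM mulVf ?gt_eqF// powRr1 ?(ltW Iq0)//.
rewrite powR_subr// powRr1 ?(ltW q0)// -powR_inv1 ?(ltW q0)// -powRrM mulN1r powRN.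
by rewrite -!mulrA [I * _]mulrC -!mulrA.
Qed.

(** The integral is a difference of two suprema over simple functions, so it is
monotone for functions which need be neither measurable nor integrable. *)
Lemma le_integral_subset d (T : measurableType d) (R : realType)
    (m : {measure set T -> \bar R}) (A B : set T) (f g : T -> \bar R) :
  A `<=` B -> (forall x, A x -> (f x <= g x)%E) ->
  (forall x, B x -> ~ A x -> (0 <= g x)%E) ->
  (\int[m]_(x in A) f x <= \int[m]_(x in B) g x)%E.
Proof.
move=> AB fg g0; have fgD : forall x, ((f \_ A) x <= (g \_ B) x)%E.
  move=> x; rewrite !patchE; have [xA|xA] := boolP (x \in A).
    by move: xA => /[!inE] xA; rewrite mem_set ?fg//; exact: AB.
  case: ifPn => // /[!inE] Bx; apply: g0 => //.
  by move: xA; rewrite notin_setE.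
rewrite /integral; apply: leeB; apply: le_ereal_sup => _ [h hle <-].
  exists h => // x; apply: (le_trans (hle x)); rewrite !funeposE.
  by rewrite ge_max !le_max fgD lexx orbT.
exists h => // x; apply: (le_trans (hle x)); rewrite !funenegE.
by rewrite ge_max !le_max leeN2 fgD lexx orbT.
Qed.

Lemma le_integral_pointwise d (T : measurableType d) (R : realType)
    (m : {measure set T -> \bar R}) (D : set T) (f g : T -> \bar R) :
  (forall x, D x -> (f x <= g x)%E) ->
  (\int[m]_(x in D) f x <= \int[m]_(x in D) g x)%E.
Proof. by move=> fg; apply: le_integral_subset. Qed.

Lemma integral_pos d (T : measurableType d) (R : realType)
    (m : {measure set T -> \bar R}) (D : set T) (f : T -> R) :
  measurable D -> measurable_fun D (fun x => (f x)%:E) ->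
  (forall x, D x -> 0 < f x) -> (0 < m D)%E ->
  (0 < \int[m]_(x in D) (f x)%:E)%E.
Proof.
move=> mD mf f0 mD0; rewrite lt_neqAle eq_sym integral_ge0 ?andbT//; last first.
  by move=> x /f0 /ltW; rewrite lee_fin.
apply/eqP => I0.
have f_ae0 : ae_eq m D (fun x => (f x)%:E) (cst 0%E).
  apply/ae_eq_integral_abs => //.
  rewrite -[RHS]I0; apply: eq_integral => x /[!inE] /f0 fx.
  by rewrite /= gtr0_norm.
move: mD0; rewrite (_ : m _ = 0%E) ?ltxx//; apply/negligibleP => //.
apply: negligibleS f_ae0 => x Dx /= /(_ Dx) [fx].
by have := f0 x Dx; rewrite fx ltxx.
Qed.

(** Writing K h = (K / Q) (h Q), the first hypothesis on the kernel bounds the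
mass of the measure K / Q dm, so that the r-th power of the inner integral is
dominated by the integral of (h Q)^r against that measure; the second
hypothesis then closes the estimate after exchanging the integrals. *)
Lemma schur_test d (T : measurableType d) (R : realType)
    (m : {sigma_finite_measure set T -> \bar R}) (D : set T)
    (K : T * T -> R) (Q : T -> R) (r A B : R) :
  measurable D -> measurable_fun setT K -> measurable_fun setT Q ->
  1 <= r -> 0 <= A -> 0 <= B ->
  (forall x, 0 <= K x) -> (forall x, D x -> 0 < Q x) ->
  (forall t, D t ->
     (\int[m]_(s in D) (K (t, s) * (Q s)^-1)%:E <= (A * (Q t)^-1)%:E)%E) ->
  (forall s, D s ->
     (\int[m]_(t in D) (K (t, s) * (Q t) `^ (1 - r))%:E
      <= (B * (Q s) `^ (1 - r))%:E)%E) ->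
  forall h : T -> \bar R, measurable_fun D h -> (forall x, D x -> (0 <= h x)%E) ->
  (\int[m]_(t in D) (\int[m]_(s in D) ((K (t, s))%:E * h s)) `^ r <=
   ((A + 1) `^ r * B)%:E * \int[m]_(t in D) h t `^ r)%E.
Proof.
move=> mD mK mQ r1 A0 B0 K0 Q0 KA KB h mh h0.
have r0 : 0 < r by apply: lt_le_trans r1.
have mKt t : measurable_fun setT (fun s => K (t, s)).
  by apply: (measurableT_comp mK); exact: measurable_pair1.
have mKs s : measurable_fun setT (fun t => K (t, s)).
  by apply: (measurableT_comp mK); exact: measurable_pair2.
have mhr : measurable_fun D (fun s => h s `^ r)%E.
  by apply: (measurableT_comp (measurable_poweR r)).
have mQr e : measurable_fun setT (fun s => Q s `^ e).
  exact: (@measurableT_comp _ _ _ _ _ _ (@powR R ^~ e)).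
pose I t := (\int[m]_(s in D) ((K (t, s) * Q s `^ (r - 1))%:E * h s `^ r))%E.
have I0 t : (0 <= I t)%E.
  apply: integral_ge0 => s Ds.
  by rewrite mule_ge0 ?poweR_ge0// lee_fin mulr_ge0// powR_ge0.
have mI' t : measurable_fun D (fun s => (K (t, s) * Q s `^ (r - 1))%:E * h s `^ r)%E.
  apply: emeasurable_funM => //.
  by apply/measurable_EFinP/measurable_funTS/measurable_funM.
have KI0' t s : D s -> (0 <= (K (t, s) * Q s `^ (r - 1))%:E * h s `^ r)%E.
  by move=> Ds; rewrite mule_ge0 ?poweR_ge0// lee_fin mulr_ge0// powR_ge0.
have step1 t : D t -> ((\int[m]_(s in D) ((K (t, s))%:E * h s)) `^ r <=
    ((A + 1) `^ r * Q t `^ (1 - r))%:E * I t)%E.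
  move=> Dt; apply: poweR_optimize => //.
  - exact: Q0.
  - by apply: integral_ge0 => s Ds; rewrite mule_ge0// ?h0// lee_fin.
  move=> c c0.
  apply: (@le_trans _ _ (\int[m]_(s in D) (c%:E * (K (t, s) * (Q s)^-1)%:E +
     (c `^ (1 - r))%:E * ((K (t, s) * Q s `^ (r - 1))%:E * h s `^ r)))%E).
    apply: le_integral_pointwise => s Ds.
    have Qs := Q0 _ Ds.
    have Qhr : ((h s * (Q s)%:E) `^ r = h s `^ r * (Q s `^ r)%:E)%E.
      by rewrite poweRM ?h0// lee_fin ltW.
    have hQ0 : (0 <= h s * (Q s)%:E)%E by rewrite mule_ge0 ?h0// lee_fin ltW.
    have KQ0 : 0 <= K (t, s) * (Q s)^-1 by rewrite mulr_ge0// invr_ge0 ltW.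
    have : ((K (t, s) * (Q s)^-1)%:E * (h s * (Q s)%:E) <=
        (K (t, s) * (Q s)^-1)%:E *
        (c%:E + (c `^ (1 - r))%:E * (h s * (Q s)%:E) `^ r))%E.
      by rewrite lee_wpmul2l ?lee_fin// le_add_poweR.
    rewrite Qhr ge0_muleDr ?lee_fin ?(ltW c0)//; last first.
      by rewrite !mule_ge0 ?poweR_ge0// lee_fin powR_ge0.
    have -> : ((K (t, s) * (Q s)^-1)%:E * (h s * (Q s)%:E) = (K (t, s))%:E * h s)%E.
      rewrite (muleC (h s)) muleA -EFinM -mulrA mulVf ?mulr1// gt_eqF//.
    move=> /le_trans; apply; rewrite (muleC _ c%:E) leeD2l//.
    rewrite (muleC (h s `^ r)) !muleA -!EFinM (@powR_subr _ (Q s))// powRr1 ?(ltW Qs)//.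
    by rewrite lee_wpmul2r ?poweR_ge0// lee_fin le_eqVlt; apply/predU1P; left; ring.
  have mKQ : measurable_fun D (fun s => (K (t, s) * (Q s)^-1)%:E).
    apply/measurable_EFinP/measurable_funM; first exact/measurable_funTS.
    apply: (eq_measurable_fun (fun s => Q s `^ (-1))).
      by move=> s /[!inE] /Q0 Qs; rewrite powR_inv1// ltW.
    exact/measurable_funTS.
  have KQ0 s : D s -> (0 <= (K (t, s) * (Q s)^-1)%:E)%E.
    by move=> Ds; rewrite lee_fin mulr_ge0// invr_ge0 ltW// Q0.
  rewrite ge0_integralD//; last 4 first.
  - by move=> s Ds; rewrite mule_ge0 ?KQ0// lee_fin ltW.
  - exact: measurable_funeM.
  - by move=> s Ds; rewrite mule_ge0 ?KI0'// lee_fin powR_ge0.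
  - exact: measurable_funeM.
  rewrite !ge0_integralZl ?lee_fin ?powR_ge0 ?(ltW c0)//; last exact: KI0'.
  rewrite leeD2r// EFinM lee_wpmul2l ?KA// lee_fin ltW//.
apply: (@le_trans _ _ (\int[m]_(t in D)
    (((A + 1) `^ r)%:E * ((Q t `^ (1 - r))%:E * I t)))%E).
  by apply: le_integral_pointwise => t /step1; rewrite EFinM muleA.
(* the double integrand, extended by zero so as to be measurable on T * T *)
pose F (z : T * T) := (((K z * Q z.2 `^ (r - 1) * Q z.1 `^ (1 - r))
   * \1_D z.1)%:E * (((fun s => h s `^ r) \_ D) z.2))%E.
have mF : measurable_fun setT F.
  apply: emeasurable_funM.
    apply/measurable_EFinP; apply: measurable_funM; last first.
      exact: (measurableT_comp (measurable_indic _)).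
    apply: measurable_funM; last exact: (measurableT_comp (mQr _)).
    by apply: measurable_funM => //; exact: (measurableT_comp (mQr _)).
  have mhD : measurable_fun setT ((fun s => h s `^ r)%E \_ D).
    exact/(measurable_restrictT _ mD).
  exact: (measurableT_comp mhD).
have F0 z : (0 <= F z)%E.
  rewrite mule_ge0//; first by rewrite lee_fin !mulr_ge0// powR_ge0.
  by rewrite patchE; case: ifP => // _; exact: poweR_ge0.
have IF t : (\int[m]_s F (t, s) =
    (\1_D t)%:E * ((Q t `^ (1 - r))%:E * I t))%E.
  rewrite /I -!ge0_integralZl ?lee_fin ?powR_ge0//; last 3 first.
  - exact/measurable_funeM.
  - by move=> s Ds; rewrite mule_ge0 ?KI0' ?lee_fin ?powR_ge0.
  - exact: KI0'.
  rewrite [RHS]integral_mkcond; apply: eq_integral => s _.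
  rewrite /F patchE [in RHS]patchE/=; case: ifP => _; last by rewrite mule0.
  by rewrite !muleA -!EFinM; congr (_%:E * _)%E; ring.
rewrite ge0_integralZl ?lee_fin ?powR_ge0//; last 2 first.
- apply: (eq_measurable_fun (fun t => \int[m]_s F (t, s))%E); last first.
    by apply/measurable_funTS; exact: measurable_fun_fubini_tonelli_F.
  by move=> t /[!inE] Dt; rewrite IF indicE mem_set// mul1e.
- by move=> t _; rewrite mule_ge0// lee_fin powR_ge0.
have -> : (\int[m]_(t in D) ((Q t `^ (1 - r))%:E * I t) =
  \int[m]_t \int[m]_s F (t, s))%E.
  rewrite integral_mkcond; apply: eq_integral => t _; rewrite IF patchE indicE.
  by case: ifP => _; rewrite ?mul1e ?mul0e.
rewrite fubini_tonelli// EFinM -muleA lee_wpmul2l ?lee_fin ?powR_ge0//.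
rewrite -ge0_integralZl ?lee_fin//; last by move=> t _; exact: poweR_ge0.
rewrite [leRHS]integral_mkcond.
apply: le_integral_pointwise => s _; rewrite /F/= !patchE.
case: ifPn => [/[!inE] Ds|_]; last by rewrite integral0_eq// => t _; rewrite mule0.
apply: (@le_trans _ _ (\int[m]_(t in D) ((Q s `^ (r - 1))%:E * h s `^ r *
    (K (t, s) * Q t `^ (1 - r))%:E))%E).
  rewrite [leRHS]integral_mkcond; apply: le_integral_pointwise => t _.
  rewrite patchE indicE; case: ifPn => _; last by rewrite mulr0 mul0e.
  rewrite mulr1 [leRHS]muleC muleA -EFinM le_eqVlt; apply/predU1P; left.
  by congr (_%:E * _)%E; ring.
rewrite ge0_integralZl//; last 3 first.
- by apply/measurable_EFinP/measurable_funTS/measurable_funM.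
- by move=> t Dt; rewrite lee_fin mulr_ge0// powR_ge0.
- by rewrite mule_ge0 ?poweR_ge0// lee_fin powR_ge0.
apply: (@le_trans _ _ ((Q s `^ (r - 1))%:E * h s `^ r * (B * Q s `^ (1 - r))%:E))%E.
  by rewrite lee_wpmul2l ?KB// mule_ge0 ?poweR_ge0// lee_fin powR_ge0.
rewrite muleC muleA -EFinM -mulrA -powR_addr ?Q0//.
by rewrite addrA subrK subrr powRr0 mulr1.
Qed.

(** * Integrals of powers of V *)

Lemma exists_ltr_exp2 (R : realType) (x : R) : exists n, x < 2 ^+ n.
Proof.
exists (Num.truncn x).+1; apply: (lt_trans (truncnS_gt _)).
by rewrite -natrX ltr_nat ltn_expl.
Qed.

(** If the dyadic blocks {a <= Z < 2 a} all have k-mass at most c, then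
Z^-e k is summed by a geometric series. *)
Lemma dyadic_integral_le d (T : measurableType d) (R : realType)
    (m : {measure set T -> \bar R}) (D : set T) (Z k : T -> R) (e c : R) :
  measurable D -> measurable_fun setT Z -> measurable_fun setT k ->
  (forall x, 0 <= k x) -> 0 < e -> 0 <= c ->
  (forall x, D x -> 1 <= Z x) ->
  (forall a, 0 < a ->
     (\int[m]_(x in D `&` [set x | (a <= Z x < 2 * a)%R]) (k x)%:E <= c%:E)%E) ->
  (\int[m]_(x in D) (Z x `^ (- e) * k x)%:E <= (c / (1 - 2 `^ (- e)))%:E)%E.
Proof.
move=> mD mZ mk k0 e0 c0 Z1 H.
set q := 2 `^ (- e); have q0 : 0 < q by rewrite powR_gt0.
have q1 : q < 1.
  rewrite /q powRN invf_lt1 ?powR_gt0// -[ltLHS](congr1 (@^~ e) (powR1 R)).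
  by rewrite gt0_ltr_powR ?nnegrE// ltr1n.
have mI (A : interval R) : measurable (D `&` (Z @^-1` [set` A])).
  by apply: measurableI => //; rewrite -[X in measurable X]setTI; exact: mZ.
pose f x := (Z x `^ (- e) * k x)%:E.
have f0 x : (0 <= f x)%E by rewrite lee_fin mulr_ge0// powR_ge0.
have mf : measurable_fun setT f.
  apply/measurable_EFinP/measurable_funM => //.
  exact: (@measurableT_comp _ _ _ _ _ _ (@powR R ^~ (- e))).
pose B n : set T := D `&` Z @^-1` `[1, 2 ^+ n[.
have mB n : measurable (B n) by exact: mI.
have ndB : {homo B : n m / (n <= m)%N >-> (n <= m)%O}.
  move=> i j ij; apply/subsetPset => x [Dx]; rewrite /= !in_itv/= => /andP[x1 xi].
  split => //; rewrite /= in_itv/= x1 (lt_le_trans xi)//.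
  by rewrite ler_eXn2l// ltr1n.
have UB : \bigcup_n B n = D.
  apply/seteqP; split=> [x [n _ []]//|x Dx].
  have [n Zn] := exists_ltr_exp2 (Z x).
  by exists n => //; split => //=; rewrite in_itv/= Z1.
(* the blocks up to level n sum to at most c (1 - q^n) / (1 - q) *)
have /(cvge_le _) : (\int[m]_(x in B n) f x)%E @[n --> \oo] --> (\int[m]_(x in D) f x)%E.
  rewrite -UB; apply: ge0_nondecreasing_set_cvg_integral => //.
  by move=> n; exact/measurable_funTS.
apply; near=> n.
apply: (@le_trans _ _ (c / (1 - q) * (1 - q ^+ n))%:E); last first.
  rewrite lee_fin ler_piMr ?divr_ge0 ?subr_ge0 ?(ltW q1)//.
  by rewrite lerBlDr lerDl exprn_ge0// ltW.
elim: (n) => [|i IH].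
  rewrite expr0 subrr mulr0 (_ : B 0%N = set0) ?integral_set0//.
  by rewrite -subset0 => x [_]; rewrite /= in_itv/= expr0 ltNge andbN.
have -> : B i.+1 = B i `|` (D `&` [set x | (2 ^+ i <= Z x < 2 * 2 ^+ i)%R]).
  apply/seteqP; split => x.
    move=> [Dx]; rewrite /= in_itv/= exprS => /andP[x1 xi].
    by have [|xi'] := leP (2 ^+ i) (Z x); [right; split => //; apply/andP|
      left; split => //; rewrite /= in_itv/= x1].
  case=> [Bx|[Dx /= /andP[xi xi']]].
    by have /subsetPset := ndB i i.+1 (leqnSn _); exact.
  by split => //=; rewrite in_itv/= Z1// exprS.
have mE : measurable (D `&` [set x | (2 ^+ i <= Z x < 2 * 2 ^+ i)%R]).
  rewrite (_ : [set x | _] = Z @^-1` `[2 ^+ i, 2 * 2 ^+ i[); first exact: mI.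
  by apply/seteqP; split => x; rewrite /= in_itv.
rewrite ge0_integral_setU//; last 2 first.
  - exact/measurable_funTS.
  - apply/disj_setPRL => x [Dx /= /andP[xi _]] [_]; rewrite /= in_itv/=.
    by rewrite ltNge xi andbF.
apply: (@le_trans _ _ ((c / (1 - q) * (1 - q ^+ i))%:E + (q ^+ i * c)%:E)%E).
  apply: leeD => //.
  apply: (@le_trans _ _ (\int[m]_(x in D `&` [set x | (2 ^+ i <= Z x < 2 * 2 ^+ i)%R])
     ((q ^+ i)%:E * (k x)%:E))%E).
    apply: le_integral_pointwise => x [Dx /= /andP[xi _]].
    rewrite -EFinM lee_fin ler_wpM2r//.
    rewrite /q -powR_mulrn ?powR_ge0// -powRrM mulrC powRrM powR_mulrn ?ltr0n//.
    rewrite !powRN lef_pV2 ?posrE ?powR_gt0 ?exprn_gt0//; last first.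
      by rewrite (lt_le_trans _ xi)// exprn_gt0.
    by rewrite ge0_ler_powR ?nnegrE ?(ltW e0)// ?exprn_ge0// (le_trans _ xi)// exprn_ge0.
  rewrite ge0_integralZl_EFin ?exprn_ge0 ?(ltW q0)//; last 2 first.
  - by move=> x _; rewrite lee_fin.
  - exact/measurable_EFinP/measurable_funTS.
  rewrite EFinM lee_wpmul2l ?lee_fin ?exprn_ge0 ?(ltW q0)//.
  by apply: H; rewrite exprn_gt0.
rewrite -EFinD lee_fin exprS le_eqVlt; apply/predU1P; left.
field. by rewrite subr_eq0 eq_sym lt_eqF.
Unshelve. all: end_near. Qed.

Section mass.
Context (R : realType) (nu : {measure set (measurableTypeR R) -> \bar R}).
Hypothesis nu_fin : forall t, 0 < t -> (nu `]0%R, t[%classic < +oo)%E.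
Hypothesis nu_gt0 : forall t, 0 < t -> (0 < nu `]0%R, t[%classic)%E.
Hypothesis nu_atomless : forall t, nu [set t] = 0%E.

(** This is V(t), read off from the measure with density v. *)
Definition mass t := fine (nu `]0%R, t[%classic).

Lemma massE t : nu `]0%R, t[%classic = (mass t)%:E.
Proof.
rewrite /mass fineK// ge0_fin_numE//; have [/nu_fin//|t0] := ltP 0 t.
by rewrite set_itv_ge ?measure0// -leNgt.
Qed.

Lemma mass_gt0 t : 0 < t -> 0 < mass t.
Proof. by move=> /nu_gt0; rewrite massE lte_fin. Qed.

Lemma mass_nd : {homo mass : x y / x <= y}.
Proof.
move=> x y xy; rewrite -lee_fin -!massE le_measure ?inE//.
by apply: subset_itvl; rewrite bnd_simp.
Qed.

Lemma measurable_mass : measurable_fun setT mass.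
Proof. by apply: nondecreasing_measurable => //; exact: mass_nd. Qed.

Lemma massEc t : nu `]0%R, t]%classic = (mass t)%:E.
Proof.
rewrite -massE; have [t0|t0] := ltP 0 t; last first.
  by rewrite !set_itv_ge// -leNgt bnd_simp.
by rewrite -(@setUitv1 _ _ (BRight 0) t true) ?bnd_simp// measureU0.
Qed.

Lemma measurable_mass_itv (I : interval R) :
  measurable ([set s | 0 < s /\ mass s \in I] : set (measurableTypeR R)).
Proof.
rewrite (_ : [set s | _] = `]0, +oo[ `&` mass @^-1` [set` I]).
  by apply: measurableI => //; rewrite -[X in measurable X]setTI; exact: measurable_mass.
by apply/seteqP; split => s [s0 sI]; split => //; move: s0; rewrite /= in_itv/= andbT.
Qed.

Lemma measurable_mass_lt x :
  measurable ([set s | 0 < s /\ mass s < x] : set (measurableTypeR R)).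
Proof.
rewrite (_ : [set s | _] = [set s | 0 < s /\ mass s \in `]-oo, x[]).
  exact: measurable_mass_itv.
by apply/seteqP; split => s/=; rewrite in_itv.
Qed.

Lemma measurable_mass_le x :
  measurable ([set s | 0 < s /\ mass s <= x] : set (measurableTypeR R)).
Proof.
rewrite (_ : [set s | _] = [set s | 0 < s /\ mass s \in `]-oo, x]]).
  exact: measurable_mass_itv.
by apply/seteqP; split => s/=; rewrite in_itv.
Qed.

(** The sublevel set is an interval of left endpoint 0 on whose interior V
stays below x; since there are no atoms, its measure is a supremum of values
of V taken inside. *)
Lemma mass_lt_le x : 0 <= x -> (nu [set s | (0 < s /\ mass s < x)%R] <= x%:E)%E.
Proof.
move=> x0; set S := [set s | _].
have mS : measurable (S : set (measurableTypeR R)) by exact: measurable_mass_lt.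
have [[t [t0 xt]]|] := pselect (exists t, 0 < t /\ x <= mass t); last first.
  move=> H; have -> : S = \bigcup_n `]0, n.+1%:R[%classic.
    apply/seteqP; split=> [s [s0 _]|s [n _]]/=.
      exists (Num.truncn s) => //=; rewrite in_itv/= s0/=; exact: truncnS_gt.
    rewrite in_itv/= => /andP[s0 _]; split => //.
    by rewrite ltNge; apply/negP => xs; apply: H; exists s.
  have /(cvge_le _) : (nu `]0%R, n.+1%:R[%classic)%E @[n --> \oo] -->
      nu (\bigcup_n `]0%R, n.+1%:R[%classic).
    apply: (@nondecreasing_cvg_mu _ _ _ nu (fun n => `]0%R, n.+1%:R[%classic)) => //.
      exact: bigcup_measurable.
    move=> i j ij; apply/subsetPset; apply: subset_itvl.
    by rewrite bnd_simp ler_nat.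
  apply; near=> n; rewrite massE lee_fin leNgt; apply/negP => /ltW xn.
  by apply: H; exists n.+1%:R.
have [->|/set0P S0] := eqVneq S set0; first by rewrite measure0.
have ubS : ubound S t.
  move=> s [s0 sx]; rewrite leNgt; apply/negP => /ltW/mass_nd.
  by rewrite leNgt (lt_le_trans sx).
have supS : has_sup S by split => //; exists t.
set s := sup S.
apply: (@le_trans _ _ (nu `]0, s]%classic)).
  rewrite le_measure ?inE// => u Su; rewrite /= in_itv/=.
  by rewrite (proj1 Su) (ub_le_sup (proj2 supS)).
rewrite massEc -massE.
have -> : `]0, s[%classic = \bigcup_n `]0, s - n.+1%:R^-1[%classic.
  apply/seteqP; split=> [u|u [n _]]/=; rewrite !in_itv/= => /andP[u0 us].
    have [k uk] := ltr_add_invr us.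
    by exists k => //=; rewrite in_itv/= u0 ltrBrDr.
  by rewrite u0 (lt_trans us)// ltrBlDr ltrDl.
have /(cvge_le _) : nu `]0%R, (s - n.+1%:R^-1)%R[%classic @[n --> \oo] -->
    nu (\bigcup_n `]0%R, s - n.+1%:R^-1[%classic).
  apply: (@nondecreasing_cvg_mu _ _ _ nu (fun n => `]0%R, s - n.+1%:R^-1[%classic)) => //.
    exact: bigcup_measurable.
  move=> i j ij; apply/subsetPset; apply: subset_itvl.
  by rewrite bnd_simp lerD2l lerN2 lef_pV2 ?posrE// ler_nat.
apply; near=> n; rewrite massE lee_fin.
have [u [u0 ux] su] := sup_adherent (ltac:(by rewrite invr_gt0) : 0 < (n.+1%:R^-1 : R)) supS.
by rewrite (le_trans _ (ltW ux))// mass_nd// ltW.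
Unshelve. all: end_near. Qed.

(** Together with the previous lemma this says that V transports [nu] to the
Lebesgue measure of (0, nu (0, oo)). It holds because V has no jump: V exceeds
x immediately to the right of the sublevel set. *)
Lemma mass_le_ge x : (x%:E <= nu `]0%R, +oo[%classic)%E ->
  (x%:E <= nu [set s | (0 < s /\ mass s <= x)%R])%E.
Proof.
move=> xD; set S := [set s | _].
have mS : measurable (S : set (measurableTypeR R)) by exact: measurable_mass_le.
pose E := [set s | 0 < s /\ x < mass s].
have [E0|/set0P E0] := eqVneq E set0.
  apply: (le_trans xD); rewrite le_measure ?inE// => s; rewrite /= in_itv/= andbT.
  move=> s0; split => //; rewrite leNgt; apply/negP => xs.
  by have : E s by []; rewrite E0.
have infE : has_inf E by split => //; exists 0 => s [/ltW].
set s := inf E; have s0 : 0 <= s by apply: lb_le_inf => // u [/ltW].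
apply: (@le_trans _ _ (nu `]0, s]%classic)); last first.
  rewrite massEc -massE le_measure ?inE// => u; rewrite /= in_itv/= => /andP[u0 us].
  split => //; rewrite leNgt; apply/negP => xu.
  by move: us; rewrite ltNge; apply/negP/negPn; apply: inf_lbound => //; exact: (proj2 infE).
have -> : `]0, s]%classic = \bigcap_n `]0, s + n.+1%:R^-1[%classic.
  apply/seteqP; split=> u /=.
    rewrite in_itv/= => /andP[u0 us] n _ /=; rewrite in_itv/= u0/=.
    by rewrite (le_lt_trans us)// ltrDl.
  move=> H; have := H 0%N I; rewrite /= !in_itv/= => /andP[-> _]/=.
  rewrite leNgt; apply/negP => /ltr_add_invr[k].
  by apply/negP; rewrite -leNgt ltW//; have := H k I; rewrite /= in_itv/= => /andP[].
have /(cvge_ge _) : nu `]0%R, (s + n.+1%:R^-1)%R[%classic @[n --> \oo] -->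
    nu (\bigcap_n `]0%R, s + n.+1%:R^-1[%classic).
  apply: (@nonincreasing_cvg_mu _ _ _ nu (fun n => `]0%R, s + n.+1%:R^-1[%classic)) => //.
  - by rewrite massE ltry.
  - exact: bigcap_measurable.
  - move=> i j ij; apply/subsetPset; apply: subset_itvl.
    by rewrite bnd_simp lerD2l lef_pV2 ?posrE// ler_nat.
apply; near=> n; rewrite massE lee_fin.
have [u [u0 ux] su] := inf_adherent (ltac:(by rewrite invr_gt0) : 0 < (n.+1%:R^-1 : R)) infE.
by rewrite (le_trans (ltW ux))// mass_nd// ltW.
Unshelve. all: end_near. Qed.
End mass.

Section hardy.
Context (R : realType) (nu : {sigma_finite_measure set (measurableTypeR R) -> \bar R}).
Hypothesis nu_fin : forall t, 0 < t -> (nu `]0%R, t[%classic < +oo)%E.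
Hypothesis nu_gt0 : forall t, 0 < t -> (0 < nu `]0%R, t[%classic)%E.
Hypothesis nu_atomless : forall t, nu [set t] = 0%E.

Notation W := (mass nu).

Lemma measurable_mass_powR e : measurable_fun setT (fun s => W s `^ e).
Proof.
apply: (@measurableT_comp _ _ _ _ _ _ (@powR R ^~ e)) => //.
exact: measurable_mass.
Qed.

Lemma measurable_EFin_mass_powR (A : set (measurableTypeR R)) e :
  measurable_fun A (fun s => (W s `^ e)%:E).
Proof.
by apply/measurable_EFinP; apply: measurable_funTS; exact: measurable_mass_powR.
Qed.

(** The measure V^-1 dnu is the logarithmic measure in the variable V, hence
dyadic blocks have bounded mass. *)
Lemma integral_inv_mass_le b (A : set (measurableTypeR R)) : 0 < b ->
  measurable A -> (forall s, A s -> [/\ 0 < s, b <= W s & W s < 4 * b]) ->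
  (\int[nu]_(s in A) (W s `^ (-1))%:E <= 4%:E)%E.
Proof.
move=> b0 mA Ab.
apply: (@le_trans _ _ (\int[nu]_(s in A) (b^-1)%:E)%E).
  apply: le_integral_pointwise => s /Ab[s0 bs _].
  have Ws := mass_gt0 nu_fin nu_gt0 s0.
  by rewrite lee_fin powR_inv1 ?(ltW Ws)// lef_pV2 ?posrE.
rewrite (integral_cst _ _ b^-1%:E)//.
apply: (@le_trans _ _ (b^-1%:E * (4 * b)%:E)%E).
  rewrite lee_wpmul2l ?lee_fin ?invr_ge0 ?(ltW b0)//.
  apply: (le_trans _ (@mass_lt_le _ nu nu_fin nu_atomless _ _)).
    rewrite le_measure ?inE//; last by move=> s /Ab[].
    exact: measurable_mass_lt.
  by rewrite mulr_ge0// ltW.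
by rewrite -EFinM lee_fin mulrCA mulVf ?mulr1// gt_eqF.
Qed.

Definition powC (e : R) := 4 / (1 - 2 `^ (- e)).

Lemma powC_gt0 e : 0 < e -> 0 < powC e.
Proof.
move=> e0; rewrite divr_gt0// subr_gt0 powRN invf_lt1 ?powR_gt0//.
rewrite -[ltLHS](congr1 (@^~ e) (powR1 R)).
by rewrite gt0_ltr_powR ?nnegrE// ltr1n.
Qed.

Lemma integral_mass_powR_head e t : 0 < e -> 0 < t ->
  (\int[nu]_(s in `]0%R, t]) (W s `^ (e - 1))%:E <= (powC e * W t `^ e)%:E)%E.
Proof.
move=> e0 t0; have Wt := mass_gt0 nu_fin nu_gt0 t0.
pose Z s := W t * W s `^ (-1); pose k s := W s `^ (-1).
have mZ : measurable_fun setT Z by apply: measurable_funM => //; exact: measurable_mass_powR.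
have Ws s : s \in `]0%R, t] -> 0 < W s.
  by rewrite in_itv/= => /andP[s0 _]; exact: mass_gt0.
(* on (0, t] the dyadic variable is Z = V(t) / V *)
apply: (@le_trans _ _ (\int[nu]_(s in `]0%R, t])
    ((W t `^ e)%:E * (Z s `^ (- e) * k s)%:E))%E).
  apply: le_integral_pointwise => s /Ws {}Ws; rewrite -EFinM lee_fin.
  rewrite /Z /k powRM ?powR_ge0 ?(ltW Wt)// -powRrM mulN1r opprK.
  rewrite !mulrA -powR_addr// subrr powRr0 mul1r -powR_addr//.
rewrite ge0_integralZl_EFin ?powR_ge0//; last 2 first.
- by move=> s _; rewrite lee_fin mulr_ge0// powR_ge0.
- apply/measurable_EFinP/measurable_funTS/measurable_funM; last exact: measurable_mass_powR.
  exact: (@measurableT_comp _ _ _ _ _ _ (@powR R ^~ (- e))).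
rewrite [leRHS]EFinM muleC lee_wpmul2r ?lee_fin ?powR_ge0//.
apply: dyadic_integral_le => //.
- exact: measurable_mass_powR.
- by move=> s; exact: powR_ge0.
- move=> s sI; have := Ws _ sI; move: sI; rewrite /= in_itv/= => /andP[s0 st] Ws0.
  by rewrite /Z powR_inv1 ?(ltW Ws0)// ler_pdivlMr// mul1r mass_nd.
move=> a a0; apply: (@integral_inv_mass_le (W t / (2 * a))).
- by rewrite divr_gt0 ?mulr_gt0.
- apply: measurableI => //.
  suff -> : [set x | a <= Z x < 2 * a] = Z @^-1` `[a, 2 * a[.
    by rewrite -[X in measurable X]setTI; exact: mZ.
  by apply/seteqP; split => s /=; rewrite in_itv.
move=> s [sI /= /andP[aZ Za]]; have Ws0 := Ws _ sI.
move: aZ Za; rewrite /Z powR_inv1 ?(ltW Ws0)// ler_pdivlMr// ltr_pdivrMr// => aZ Za.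
split; first by move: sI; rewrite /= in_itv/= => /andP[].
  by rewrite ler_pdivrMr ?mulr_gt0// mulrC ltW.
rewrite mulrA ltr_pdivlMr ?mulr_gt0//.
by nra.
Qed.

Lemma integral_mass_powR_tail e t : 0 < e -> 0 < t ->
  (\int[nu]_(s in `[t, +oo[) (W s `^ (- e - 1))%:E <= (powC e * W t `^ (- e))%:E)%E.
Proof.
move=> e0 t0; have Wt := mass_gt0 nu_fin nu_gt0 t0.
pose Z s := (W t)^-1 * W s; pose k s := W s `^ (-1).
have mZ : measurable_fun setT Z by apply: measurable_funM => //; exact: measurable_mass.
have Ws s : s \in `[t, +oo[ -> 0 < W s.
  by rewrite in_itv/= andbT => ts; apply: mass_gt0 => //; exact: lt_le_trans ts.
apply: (@le_trans _ _ (\int[nu]_(s in `[t, +oo[)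
    ((W t `^ (- e))%:E * (Z s `^ (- e) * k s)%:E))%E).
  apply: le_integral_pointwise => s /Ws {}Ws; rewrite -EFinM lee_fin.
  rewrite /Z /k powRM ?invr_ge0 ?(ltW Wt) ?(ltW Ws)// -powR_inv1 ?(ltW Wt)//.
  rewrite -powRrM mulN1r opprK.
  rewrite !mulrA -powR_addr// addNr powRr0 mul1r -powR_addr//.
rewrite ge0_integralZl_EFin ?powR_ge0//; last 2 first.
- by move=> s _; rewrite lee_fin mulr_ge0// powR_ge0.
- apply/measurable_EFinP/measurable_funTS/measurable_funM; last exact: measurable_mass_powR.
  exact: (@measurableT_comp _ _ _ _ _ _ (@powR R ^~ (- e))).
rewrite [leRHS]EFinM muleC lee_wpmul2r ?lee_fin ?powR_ge0//.
apply: dyadic_integral_le => //.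
- exact: measurable_mass_powR.
- by move=> s; exact: powR_ge0.
- move=> s; rewrite /= in_itv/= andbT => ts.
  by rewrite /Z mulrC ler_pdivlMr// mul1r mass_nd.
move=> a a0; apply: (@integral_inv_mass_le (W t * a)).
- by rewrite mulr_gt0.
- apply: measurableI => //.
  suff -> : [set x | a <= Z x < 2 * a] = Z @^-1` `[a, 2 * a[.
    by rewrite -[X in measurable X]setTI; exact: mZ.
  by apply/seteqP; split => s /=; rewrite in_itv.
move=> s [sI /= /andP[]]; have Ws0 := Ws _ sI.
rewrite /Z mulrC ler_pdivlMr// ltr_pdivrMr// => aZ Za.
split; first by move: sI; rewrite /= in_itv/= andbT; exact: lt_le_trans.
  by rewrite mulrC.
by rewrite (lt_trans Za)//; have := mulr_gt0 Wt a0; lra.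
Qed.

(** The two powers of V are chosen so that the kernel is homogeneous of degree
-1 in V on each side of the diagonal; on the lower side it gives the averaging
operator with weight V^(a - 1), on the upper side the tail operator. *)
Definition hardy_kernel (a d : R) (z : R * R) : R :=
  if z.2 < z.1 then W z.1 `^ (- a) * W z.2 `^ (a - 1)
  else W z.1 `^ d * W z.2 `^ (- 1 - d).

Lemma measurable_hardy_kernel a d :
  measurable_fun setT (hardy_kernel a d : (measurableTypeR R * measurableTypeR R -> R)).
Proof.
have mfst e : measurable_fun setT (fun z : measurableTypeR R * measurableTypeR R => W z.1 `^ e).
  by apply: (measurableT_comp (measurable_mass_powR e)).
have msnd e : measurable_fun setT (fun z : measurableTypeR R * measurableTypeR R => W z.2 `^ e).
  by apply: (measurableT_comp (measurable_mass_powR e)).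
apply: measurable_fun_ifT; last 2 first.
- exact: measurable_funM.
- exact: measurable_funM.
by apply: measurable_fun_ltr; [exact: measurable_snd|exact: measurable_fst].
Qed.

Lemma hardy_kernel_ge0 a d z : 0 <= hardy_kernel a d z.
Proof. by rewrite /hardy_kernel; case: ifP => _; rewrite mulr_ge0// powR_ge0. Qed.

Lemma integral_itv0y_split (b : bool) t (f : measurableTypeR R -> \bar R) : 0 < t ->
  measurable_fun (`]0, +oo[ : set R) f -> (forall s, 0 < s -> (0 <= f s)%E) ->
  (\int[nu]_(s in `]0%R, +oo[) f s =
   \int[nu]_(s in [set` Interval (BRight 0%R) (BSide b t)]) f s +
   \int[nu]_(s in [set` Interval (BSide b t) +oo%O]) f s)%E.
Proof.
move=> t0 mf f0.
have U : `]0, +oo[%classic = [set` Interval (BRight 0) (BSide b t)] `|`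
    [set` Interval (BSide b t) +oo%O].
  by rewrite -itv_bndbnd_setU//; case: b; rewrite bnd_simp// ltW.
rewrite U ge0_integral_setU//.
- by rewrite -U.
- by rewrite -U => s; rewrite /= in_itv/= andbT; exact: f0.
apply/disj_setPRL => x; rewrite /= => xt /= xt'.
by move: xt xt'; rewrite !in_itv/=; case: (b) => /=; rewrite ?andbT; lra.
Qed.

(** The conditions on the exponents are exactly those under which the powers
occurring in the Schur test with weight V^(1/r) are integrable, near 0 and at
infinity respectively. *)
Lemma hardy r a d : 1 <= r -> r^-1 < a -> - r^-1 < d -> exists2 C : R, 0 < C &
  forall h : R -> \bar R, measurable_fun (`]0, +oo[ : set R) h ->
    (forall s, 0 < s -> (0 <= h s)%E) ->
  (\int[nu]_(t in `]0%R, +oo[)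
     (\int[nu]_(s in `]0%R, +oo[) ((hardy_kernel a d (t, s))%:E * h s)) `^ r
   <= C%:E * \int[nu]_(t in `]0%R, +oo[) h t `^ r)%E.
Proof.
move=> r1 ra rd; have r0 : 0 < r by apply: lt_le_trans r1.
have e1 : 0 < a - r^-1 by rewrite subr_gt0.
have e2 : 0 < d + r^-1 by rewrite -ltrBlDr sub0r.
set c1 := powC (a - r^-1); set c2 := powC (d + r^-1).
have c10 : 0 < c1 by exact: powC_gt0.
have c20 : 0 < c2 by exact: powC_gt0.
pose Q s := W s `^ r^-1.
have mQ : measurable_fun setT Q by exact: measurable_mass_powR.
have mK := measurable_hardy_kernel a d.
exists ((c1 + c2 + 1) `^ r * (c1 + c2)).
  by rewrite mulr_gt0 ?powR_gt0// ?addr_gt0.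
move=> h mh h0; apply: (@schur_test _ _ R nu `]0, +oo[ (hardy_kernel a d) Q) => //.
- by rewrite addr_ge0// ltW.
- by rewrite addr_ge0// ltW.
- by move=> z; exact: hardy_kernel_ge0.
- by move=> x; rewrite /= in_itv/= andbT => x0; rewrite powR_gt0// mass_gt0.
- move=> t; rewrite /= in_itv/= andbT => t0.
  have Wt := mass_gt0 nu_fin nu_gt0 t0.
  rewrite (@integral_itv0y_split true t)//; last 2 first.
  + apply/measurable_EFinP/measurable_funTS/measurable_funM.
      by apply: (measurableT_comp mK); exact: measurable_pair1.
    apply: (eq_measurable_fun (fun s => W s `^ (- r^-1))).
      by move=> s _; rewrite powRN.
    exact: measurable_mass_powR.
  + by move=> s _; rewrite lee_fin mulr_ge0 ?hardy_kernel_ge0// invr_ge0 powR_ge0.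
  rewrite mulrDl EFinD; apply: leeD.
    apply: (@le_trans _ _ (\int[nu]_(s in `]0%R, t])
      ((W t `^ (- a))%:E * (W s `^ (a - r^-1 - 1))%:E))%E).
      apply: le_integral_subset => [s|s|s _ _].
      + by rewrite /= !in_itv/= => /andP[-> /ltW].
      + rewrite /= in_itv/= => /andP[s0 st]; rewrite /hardy_kernel/= st -EFinM lee_fin.
        have Ws := mass_gt0 nu_fin nu_gt0 s0.
        by rewrite -powRN -!mulrA -powR_addr// addrAC.
      + by rewrite -EFinM lee_fin mulr_ge0// powR_ge0.
    rewrite ge0_integralZl_EFin ?powR_ge0//; last 2 first.
    + by move=> s _; rewrite lee_fin powR_ge0.
    + exact: measurable_EFin_mass_powR.
    apply: (le_trans (lee_wpmul2l _ (integral_mass_powR_head e1 t0))).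
      by rewrite lee_fin powR_ge0.
    by rewrite -EFinM lee_fin mulrCA -powR_addr// addrA addNr add0r powRN.
  apply: (@le_trans _ _ (\int[nu]_(s in `[t, +oo[)
      ((W t `^ d)%:E * (W s `^ (- (d + r^-1) - 1))%:E))%E).
    apply: le_integral_pointwise => s; rewrite /= in_itv/= andbT => ts.
    rewrite /hardy_kernel/= ltNge ts/= -EFinM lee_fin.
    have Ws := mass_gt0 nu_fin nu_gt0 (lt_le_trans t0 ts).
    rewrite -powRN -!mulrA -powR_addr// opprD [X in _ <= _ * _ `^ X]addrAC.
    by rewrite (addrC (- 1)).
  rewrite ge0_integralZl_EFin ?powR_ge0//; last 2 first.
  + by move=> s _; rewrite lee_fin powR_ge0.
  + exact: measurable_EFin_mass_powR.
  apply: (le_trans (lee_wpmul2l _ (integral_mass_powR_tail e2 t0))).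
    by rewrite lee_fin powR_ge0.
  by rewrite -EFinM lee_fin mulrCA -powR_addr// opprD addrA subrr add0r powRN.
- move=> s; rewrite /= in_itv/= andbT => s0.
  have Ws := mass_gt0 nu_fin nu_gt0 s0.
  have Qr t : Q t `^ (1 - r) = W t `^ (r^-1 - 1).
    by rewrite /Q -powRrM mulrBr mulr1 mulVf// gt_eqF.
  under eq_integral do rewrite Qr.
  rewrite Qr (@integral_itv0y_split false s)//; last 2 first.
  + apply/measurable_EFinP/measurable_funTS/measurable_funM.
      by apply: (measurableT_comp mK); exact: measurable_pair2.
    exact: measurable_mass_powR.
  + by move=> t _; rewrite lee_fin mulr_ge0 ?hardy_kernel_ge0// powR_ge0.
  rewrite (addrC c1) mulrDl EFinD; apply: leeD.
    apply: (@le_trans _ _ (\int[nu]_(t in `]0%R, s])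
      ((W s `^ (- 1 - d))%:E * (W t `^ (d + r^-1 - 1))%:E))%E).
      apply: le_integral_pointwise => t; rewrite /= in_itv/= => /andP[t0 ts].
      have Wt := mass_gt0 nu_fin nu_gt0 t0.
      rewrite /hardy_kernel/= ltNge ts/= -EFinM lee_fin.
      by rewrite mulrAC -powR_addr// addrA mulrC.
    rewrite ge0_integralZl_EFin ?powR_ge0//; last 2 first.
    + by move=> t _; rewrite lee_fin powR_ge0.
    + exact: measurable_EFin_mass_powR.
    apply: (le_trans (lee_wpmul2l _ (integral_mass_powR_head e2 s0))).
      by rewrite lee_fin powR_ge0.
    rewrite -EFinM lee_fin mulrCA -powR_addr//.
    by rewrite (_ : -1 - d + (d + r^-1) = r^-1 - 1)//; ring.
  apply: (@le_trans _ _ (\int[nu]_(t in `[s, +oo[)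
      ((W s `^ (a - 1))%:E * (W t `^ (- (a - r^-1) - 1))%:E))%E).
    apply: le_integral_subset => [t|t|t _ _].
    + by rewrite /= !in_itv/= !andbT => /ltW.
    + rewrite /= in_itv/= andbT => st; rewrite /hardy_kernel/= st -EFinM lee_fin.
      have Wt := mass_gt0 nu_fin nu_gt0 (lt_trans s0 st).
      by rewrite mulrAC -powR_addr// mulrC opprB addrA (addrC r^-1).
    + by rewrite -EFinM lee_fin mulr_ge0// powR_ge0.
  rewrite ge0_integralZl_EFin ?powR_ge0//; last 2 first.
  + by move=> t _; rewrite lee_fin powR_ge0.
  + exact: measurable_EFin_mass_powR.
  apply: (le_trans (lee_wpmul2l _ (integral_mass_powR_tail e1 s0))).
    by rewrite lee_fin powR_ge0.
  rewrite -EFinM lee_fin mulrCA -powR_addr//.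
  by rewrite (_ : a - 1 - (a - r^-1) = r^-1 - 1)//; ring.
by move=> x; rewrite /= in_itv/= andbT; exact: h0.
Qed.

(** At least half of the mass of (0, t) lies where V >= V(t) / 2, and there
V^(b - 1) is comparable to V(t)^(b - 1) whatever the sign of b - 1. *)
Lemma integral_mass_powR_head_ge b : 0 < b -> exists2 c : R, 0 < c &
  forall t, 0 < t ->
  ((c * W t `^ b)%:E <= \int[nu]_(s in `]0%R, t[) (W s `^ (b - 1))%:E)%E.
Proof.
move=> b0; pose c : R := Num.min 1 (2^-1 `^ (b - 1)).
have c0 : 0 < c by rewrite lt_min ltr01 powR_gt0// invr_gt0.
exists (c * 2^-1); first by rewrite mulr_gt0// invr_gt0.
move=> t t0; have Wt := mass_gt0 nu_fin nu_gt0 t0.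
pose A := `]0, t[%classic `&` [set s | W t / 2 <= W s].
have mA : measurable (A : set (measurableTypeR R)).
  apply: measurableI => //.
  suff -> : [set s | W t / 2 <= W s] = W @^-1` `[W t / 2, +oo[.
    by rewrite -[X in measurable X]setTI; apply: measurable_mass.
  by apply/seteqP; split => s; rewrite /= in_itv/= andbT.
have nuA : ((W t / 2)%:E <= nu A)%E.
  have mB := measurable_mass_lt nu_fin (W t / 2).
  have : (nu `]0%R, t[%classic <= (W t / 2)%:E + nu A)%E.
    apply: (le_trans (le_measure nu _ _ _) (le_trans (measureU2 nu mB mA) _)).
    - by rewrite inE.
    - by rewrite inE; exact: measurableU.
    - move=> s; rewrite /A/= in_itv/= => /andP[s0 st].
      by have [?|?] := ltP (W s) (W t / 2); [left|right]; rewrite ?s0.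
    by rewrite leeD2r// mass_lt_le// divr_ge0// ltW.
  rewrite (massE nu_fin) -leeBlDl// -EFinB; apply: le_trans.
  by rewrite lee_fin; lra.
apply: (@le_trans _ _ (\int[nu]_(s in A) (c * W t `^ (b - 1))%:E)%E); last first.
  apply: le_integral_subset => [s []//|s [sI /= Wts]|s _ _]; last by rewrite lee_fin powR_ge0.
  move: sI; rewrite /= in_itv/= => /andP[s0 st].
  have Ws := mass_gt0 nu_fin nu_gt0 s0; have Wst := mass_nd nu_fin (ltW st).
  rewrite lee_fin; have [b1|b1] := leP 0 (b - 1).
    apply: (@le_trans _ _ (2^-1 `^ (b - 1) * W t `^ (b - 1))).
      by rewrite ler_wpM2r ?powR_ge0// ge_min lexx orbT.
    rewrite -powRM ?invr_ge0 ?(ltW Wt)//; apply: ge0_ler_powR; rewrite ?nnegrE ?(ltW Ws)//.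
      by rewrite mulr_ge0 ?invr_ge0 ?(ltW Wt).
    by rewrite mulrC.
  apply: (@le_trans _ _ (1 * W t `^ (b - 1))).
    by rewrite ler_wpM2r ?powR_ge0// ge_min lexx.
  rewrite mul1r -[b - 1]opprB !powRN lef_pV2 ?posrE ?powR_gt0//.
  by rewrite ge0_ler_powR ?nnegrE ?(ltW Ws) ?(ltW Wt)//; lra.
rewrite (integral_cst _ _ (c * W t `^ (b - 1))%:E)//.
apply: le_trans (lee_wpmul2l _ nuA); last by rewrite lee_fin mulr_ge0 ?powR_ge0// ltW.
rewrite -EFinM lee_fin le_eqVlt; apply/predU1P; left.
have -> : W t `^ b = W t `^ (b - 1) * W t.
  by rewrite -[X in _ * X]powRr1 ?(ltW Wt)// -powR_addr// subrK.
by ring.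
Qed.

(** The hypothesis on the total mass ensures that the part of (t, oo) where
V <= 2 V(t) still carries a mass of at least V(t). *)
Lemma integral_mass_powR_tail_ge q t : 0 <= q -> 0 < t ->
  ((2 * W t)%:E <= nu `]0%R, +oo[%classic)%E ->
  ((2 `^ (- q) * W t `^ (1 - q))%:E <=
     \int[nu]_(s in `]t, +oo[) (W s `^ (- q))%:E)%E.
Proof.
move=> q0 t0 tD; have Wt := mass_gt0 nu_fin nu_gt0 t0.
pose A := `]t, +oo[%classic `&` [set s | W s <= 2 * W t].
have mA : measurable (A : set (measurableTypeR R)).
  apply: measurableI => //.
  suff -> : [set s | W s <= 2 * W t] = W @^-1` `]-oo, 2 * W t].
    by rewrite -[X in measurable X]setTI; apply: measurable_mass.
  by apply/seteqP; split => s; rewrite /= in_itv.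
have nuA : ((W t)%:E <= nu A)%E.
  have mB := measurable_mass_le nu_fin (2 * W t).
  have : ((2 * W t)%:E <= (W t)%:E + nu A)%E.
    apply: (le_trans (mass_le_ge nu_fin nu_atomless tD)).
    rewrite -(massEc nu_fin nu_atomless).
    apply: (le_trans (le_measure nu _ _ _) (measureU2 nu _ mA)) => //.
    - by rewrite inE.
    - by rewrite inE; exact: measurableU.
    - move=> s [s0 sW]; have [st|st] := leP s t; [left|right; split => //];
      by rewrite /= in_itv/= ?s0 ?andbT.
  rewrite -leeBlDl// -EFinB; apply: le_trans.
  by rewrite lee_fin; lra.
apply: (@le_trans _ _ (\int[nu]_(s in A) ((2 * W t) `^ (- q))%:E)%E); last first.
  apply: le_integral_subset => [s []//|s [sI /= Wts]|s _ _]; last by rewrite lee_fin powR_ge0.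
  move: sI; rewrite /= in_itv/= andbT => st.
  have Ws := mass_gt0 nu_fin nu_gt0 (lt_trans t0 st).
  rewrite lee_fin !powRN lef_pV2 ?posrE ?powR_gt0 ?mulr_gt0//.
  by rewrite ge0_ler_powR ?nnegrE ?(ltW Ws)// mulr_ge0// ltW.
rewrite (integral_cst _ _ ((2 * W t) `^ (- q))%:E)//.
apply: le_trans (lee_wpmul2l _ nuA); last by rewrite lee_fin powR_ge0.
rewrite -EFinM lee_fin powRM ?(ltW Wt)// -mulrA.
by rewrite -[X in _ <= _ * (_ * X)]powRr1 ?(ltW Wt)// -powR_addr// addrC.
Qed.
End hardy.

(** * Functions on the half-line *)

Section Mplus_theory.
Context (R : realType).
Implicit Types f g : R -> \bar R.

Definition nonincreasing_pos g := forall x y : R, 0 < x -> x <= y -> (g y <= g x)%E.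

Lemma eq_Mplus f g : Mplus f -> (forall t, 0 < t -> f t = g t) -> Mplus g.
Proof.
move=> [mf f0] fg; split; last by move=> t t0; rewrite -fg// f0.
apply: eq_measurable_fun mf => t; rewrite inE/= in_itv/= andbT; exact: fg.
Qed.

Lemma MplusM f g : Mplus f -> Mplus g -> Mplus (fun t => f t * g t)%E.
Proof.
move=> [mf f0] [mg g0]; split; first exact: emeasurable_funM.
by move=> t t0; rewrite mule_ge0 ?f0 ?g0.
Qed.

Lemma Mplus_poweR f r : Mplus f -> Mplus (fun t => f t `^ r)%E.
Proof.
move=> [mf f0]; split; last by move=> t _; exact: poweR_ge0.
exact: (measurableT_comp (measurable_poweR r)).
Qed.

Lemma Mplus_cst (c : R) : 0 <= c -> Mplus (fun _ : R => c%:E).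
Proof. by move=> c0; split. Qed.

Lemma nonincreasing_measurable_fun g :
  nonincreasing_pos g -> measurable_fun (`]0, +oo[ : set R) g.
Proof.
move=> gd; apply: (measurability _ (ErealGenCInfty.measurableE R)) => /= _ [_ [r ->] <-].
apply: is_interval_measurable => s t /= [s0 gs] [t0 gt] u /andP[su ut].
move: s0 gs t0 gt; rewrite /= !in_itv/= !andbT => s0 gs t0 gt.
split; first exact: lt_le_trans su.
by rewrite (le_trans gt)// gd// (lt_le_trans s0).
Qed.

Lemma nondecreasing_measurable_fun g :
  (forall x y : R, 0 < x -> x <= y -> (g x <= g y)%E) ->
  measurable_fun (`]0, +oo[ : set R) g.
Proof.
move=> gd; apply: (measurability _ (ErealGenCInfty.measurableE R)) => /= _ [_ [r ->] <-].
apply: is_interval_measurable => s t /= [s0 gs] [t0 gt] u /andP[su ut].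
move: s0 gs t0 gt; rewrite /= !in_itv/= !andbT => s0 gs t0 gt.
have u0 := lt_le_trans s0 su; split => //.
by rewrite (le_trans gs)// gd.
Qed.

Lemma Mplus_nonincreasing g : nonincreasing_pos g ->
  (forall t, 0 < t -> (0 <= g t)%E) -> Mplus g.
Proof. by move=> gd g0; split => //; exact: nonincreasing_measurable_fun. Qed.

Lemma EFin_powR_ge0 (x e : R) : (0 <= (x `^ e)%:E)%E.
Proof. by rewrite lee_fin powR_ge0. Qed.

Lemma itv0_sub (t : R) : `]0, t[ `<=` (`]0, +oo[ : set R).
Proof. by move=> s; rewrite /= !in_itv/= andbT => /andP[]. Qed.

Lemma itvy_sub (t : R) : 0 < t -> `]t, +oo[ `<=` (`]0, +oo[ : set R).
Proof. by move=> t0 s; rewrite /= !in_itv/= !andbT; exact: lt_trans. Qed.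

Lemma Mplus_integralZl (m : {measure set (measurableTypeR R) -> \bar R})
    (A : set R) (c : \bar R) f :
  measurable (A : set (measurableTypeR R)) -> A `<=` (`]0, +oo[ : set R) ->
  Mplus f -> (0 <= c)%E ->
  (c * \int[m]_(s in A) f s = \int[m]_(s in A) (c * f s))%E.
Proof.
move=> mA AD [mf f0] c0; rewrite ge0_integralZl//; first exact: measurable_funS mf.
by move=> s /AD; rewrite /= in_itv/= andbT; exact: f0.
Qed.

End Mplus_theory.

(** * Averages, tails and nonincreasing functions *)

Section decreasing_functions.
Context (R : realType) (nu : {sigma_finite_measure set (measurableTypeR R) -> \bar R}).
Hypothesis nu_fin : forall t, 0 < t -> (nu `]0%R, t[%classic < +oo)%E.
Hypothesis nu_gt0 : forall t, 0 < t -> (0 < nu `]0%R, t[%classic)%E.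
Hypothesis nu_atomless : forall t, nu [set t] = 0%E.
Context (rho : (R -> \bar R) -> \bar R) (p : R).
Hypothesis rho_submonotone : submonotone rho.
Hypothesis p_gt1 : 1 < p.

Notation W := (mass nu).
Implicit Types f g : R -> \bar R.

Let p0 : 0 < p. Proof. exact: lt_trans p_gt1. Qed.

Definition navg f t := ((W t)^-1%:E * \int[nu]_(s in `]0%R, t[) f s)%E.

Definition ntail f t := (\int[nu]_(s in `]t, +oo[) (f s * (W s `^ (-1))%:E))%E.

(** The inequality to which everything is reduced. *)
Definition decreasing_bound C := forall g, Mplus g -> nonincreasing_pos g ->
  (rho g <= C%:E * (\int[nu]_(t in `]0%R, +oo[) (g t `^ p)) `^ p^-1)%E.

(** Monotonicity applied twice: [rho] only sees the values on (0, oo). *)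
Lemma rho_ext f g : Mplus f -> (forall t, 0 < t -> f t = g t) -> rho f = rho g.
Proof.
move=> Mf fg; have Mg := eq_Mplus Mf fg.
apply/eqP; rewrite eq_le !(proj1 rho_submonotone)// => t t0; by rewrite fg.
Qed.

Lemma rho_scale : exists2 K : R, 0 < K & forall (l : R) f g, 0 <= l ->
  Mplus f -> Mplus g -> (forall t, 0 < t -> (f t <= l%:E * g t)%E) ->
  (rho f <= (K * l)%:E * rho g)%E.
Proof.
have [mono [K [K0 _ KM]]] := rho_submonotone.
exists K => // l f g l0 Mf Mg fg; rewrite EFinM; apply: le_trans (KM _ _ l0 Mg).
by apply: mono => //; apply: MplusM => //; exact: Mplus_cst.
Qed.

Lemma Mplus_mass e : Mplus (fun t => (W t `^ e)%:E).
Proof.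
split; last by move=> t _; rewrite lee_fin powR_ge0.
exact: measurable_EFin_mass_powR.
Qed.

Lemma Mplus_itv_measurable f (A : set R) : Mplus f -> A `<=` `]0, +oo[ ->
  measurable_fun (A : set (measurableTypeR R)) f.
Proof. by move=> [mf _] /measurable_funS; apply. Qed.

Lemma Mplus_primitive f : Mplus f -> Mplus (fun t => \int[nu]_(s in `]0%R, t[) f s)%E.
Proof.
move=> [mf f0]; split; last first.
  by move=> t _; apply: integral_ge0 => s; rewrite /= in_itv/= => /andP[s0 _]; exact: f0.
apply: nondecreasing_measurable_fun => x y x0 xy.
apply: le_integral_subset => // s; rewrite /= !in_itv/=.
  by move=> /andP[-> /lt_le_trans]; apply.
by move=> /andP[s0 _] _; exact: f0.
Qed.

Lemma Mplus_navg f : Mplus f -> Mplus (navg f).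
Proof.
move=> Mf; have := MplusM (Mplus_mass (-1)) (Mplus_primitive Mf).
move/eq_Mplus; apply => t t0.
by rewrite powR_inv1// ltW// mass_gt0.
Qed.

Lemma nonincreasing_ntail f : Mplus f -> nonincreasing_pos (ntail f).
Proof.
move=> [mf f0] x y x0 xy; apply: le_integral_subset => // s; rewrite /= !in_itv/= !andbT.
  exact: le_lt_trans.
by move=> xs _; rewrite mule_ge0 ?f0 ?lee_fin ?powR_ge0// (lt_trans x0).
Qed.

Lemma ntail_ge0 f t : Mplus f -> 0 < t -> (0 <= ntail f t)%E.
Proof.
move=> [mf f0] t0; apply: integral_ge0 => s; rewrite /= in_itv/= andbT => ts.
by rewrite mule_ge0 ?f0 ?lee_fin ?powR_ge0// (lt_trans t0).
Qed.

Lemma Mplus_ntail f : Mplus f -> Mplus (ntail f).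
Proof.
move=> Mf; apply: Mplus_nonincreasing; first exact: nonincreasing_ntail.
by move=> t; exact: ntail_ge0.
Qed.

(** The general way of proving an operator inequality: replace T f by a
nonincreasing majorant whose norm is under control. *)
Lemma majorant_bound C C0 T G (N : \bar R) : 0 <= C -> 0 <= C0 -> (0 <= N)%E ->
  decreasing_bound C -> Mplus T -> Mplus G -> nonincreasing_pos G ->
  (forall t, 0 < t -> (T t <= G t)%E) ->
  (\int[nu]_(t in `]0%R, +oo[) (G t `^ p) <= C0%:E * N)%E ->
  (rho T <= (C * C0 `^ p^-1)%:E * N `^ p^-1)%E.
Proof.
move=> C_ge0 C00 N0 decC MT MG Gd TG GN.
apply: (le_trans (proj1 rho_submonotone _ _ MT MG TG)).
apply: (le_trans (decC _ MG Gd)); rewrite EFinM -muleA lee_wpmul2l ?lee_fin//.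
rewrite -poweR_EFin -poweRM ?lee_fin//.
apply: gt0_ler_poweR => //; rewrite ?in_itv/= ?leey ?andbT.
- by rewrite invr_ge0 ltW.
- by apply: integral_ge0 => t _; exact: poweR_ge0.
- by rewrite mule_ge0.
Qed.

Lemma poweR_ler (x y : \bar R) e : 0 <= e -> (0 <= x)%E -> (x <= y)%E -> (x `^ e <= y `^ e)%E.
Proof.
move=> e0 x0 xy; apply: gt0_ler_poweR => //; rewrite in_itv/= ?leey ?andbT//.
exact: le_trans xy.
Qed.

Lemma poweR_nonincreasing g e : 0 <= e -> Mplus g -> nonincreasing_pos g ->
  nonincreasing_pos (fun t => g t `^ e)%E.
Proof.
move=> e0 [_ g0] gd x y x0 xy; apply: poweR_ler => //; last exact: gd.
by apply: g0; exact: lt_le_trans xy.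
Qed.

(** The majorant replaces the kernel V(t)^(gam - 1) 1_{s < t} by
max(V(t), V(s))^(gam - 1), which is nonincreasing in t and coincides with the
Hardy kernel of exponents (1 - gam, 0) acting on f V^gam. *)
Lemma average_bound C r gam : 0 < C -> 1 <= r -> gam < 1 - r^-1 ->
  decreasing_bound C -> exists2 C' : R, 0 < C' & forall f, Mplus f ->
  (rho (fun t => navg f t `^ (r / p) * (W t `^ (gam * (r / p)))%:E) <=
   C'%:E * (\int[nu]_(t in `]0%R, +oo[) (f t `^ r * (W t `^ (gam * r))%:E)) `^ p^-1)%E.
Proof.
move=> C0 r1 gamr decC.
have r0 : 0 < r := lt_le_trans ltr01 r1.
have rp0 : 0 < r / p by rewrite divr_gt0.
have [] := @hardy _ nu nu_fin nu_gt0 nu_atomless r (1 - gam) 0 r1.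
- by rewrite ltrBrDr addrC -ltrBrDr.
- by rewrite oppr_lt0 invr_gt0.
move=> C1 C10 H; exists (C * C1 `^ p^-1); first by rewrite mulr_gt0// powR_gt0.
move=> f Mf; have [mf f0] := Mf.
pose G t := (\int[nu]_(s in `]0%R, +oo[) ((Num.max (W t) (W s) `^ (gam - 1))%:E * f s))%E.
have gam1 : 0 < 1 - gam by rewrite subr_gt0 (lt_trans gamr)// ltrBlDr ltrDl invr_gt0.
have G0 t : (0 <= G t)%E.
  apply: integral_ge0 => s; rewrite /= in_itv/= andbT => s0.
  by rewrite mule_ge0 ?f0// lee_fin powR_ge0.
have Gd : nonincreasing_pos G.
  move=> x y x0 xy; apply: le_integral_pointwise => s; rewrite /= in_itv/= andbT => s0.
  rewrite lee_wpmul2r ?f0// lee_fin -[gam - 1]opprB !powRN.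
  have Wx := mass_gt0 nu_fin nu_gt0 x0; have Wxy := mass_nd nu_fin xy.
  have mx : 0 < Num.max (W x) (W s) by rewrite lt_max Wx.
  have my : 0 < Num.max (W y) (W s) by rewrite lt_max (lt_le_trans Wx Wxy).
  rewrite lef_pV2 ?posrE ?powR_gt0// ge0_ler_powR ?nnegrE ?(ltW gam1) ?(ltW mx) ?(ltW my)//.
  by rewrite ge_max !le_max Wxy lexx orbT.
have MG : Mplus G by apply: Mplus_nonincreasing.
apply: (majorant_bound (ltW C0) (ltW C10) _ decC _ (Mplus_poweR (r / p) MG)).
- apply: integral_ge0 => t _; by rewrite mule_ge0 ?poweR_ge0// lee_fin powR_ge0.
- exact: MplusM (Mplus_poweR _ (Mplus_navg Mf)) (Mplus_mass _).
- by apply: poweR_nonincreasing => //; rewrite ltW.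
- move=> t t0; have Wt := mass_gt0 nu_fin nu_gt0 t0.
  have a0 := proj2 (Mplus_navg Mf) t t0.
  rewrite powRrM -poweR_EFin -poweRM ?lee_fin ?powR_ge0//.
  apply: poweR_ler; [exact: ltW|by rewrite mule_ge0 ?lee_fin ?powR_ge0|].
  rewrite /navg muleAC -EFinM -powR_inv1 ?(ltW Wt)// -powR_addr// addrC.
  rewrite (Mplus_integralZl nu (measurable_itv _) (@itv0_sub _ t) Mf (EFin_powR_ge0 _ _)).
  apply: le_integral_subset => s.
  + by rewrite /= !in_itv/= => /andP[->].
  + rewrite /= in_itv/= => /andP[s0 st].
    by rewrite max_l// mass_nd// ltW.
  + by rewrite /= in_itv/= andbT => s0 _; rewrite mule_ge0 ?f0 ?lee_fin ?powR_ge0.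
- have mh : measurable_fun (`]0, +oo[ : set R) (fun s => f s * (W s `^ gam)%:E)%E.
    exact: (proj1 (MplusM Mf (Mplus_mass gam))).
  have Hh := H _ mh (proj2 (MplusM Mf (Mplus_mass gam))).
  apply: le_trans (le_trans Hh _); last first.
    rewrite lee_wpmul2l ?lee_fin ?(ltW C10)//.
    apply: le_integral_pointwise => t; rewrite /= in_itv/= andbT => t0.
    by rewrite poweRM ?f0 ?lee_fin ?powR_ge0// poweR_EFin -powRrM.
  apply: le_integral_pointwise => t; rewrite /= in_itv/= andbT => t0.
  have Wt := mass_gt0 nu_fin nu_gt0 t0.
  rewrite -poweRrM divfK ?gt_eqF//; apply: poweR_ler => //; first exact: ltW.
  apply: le_integral_pointwise => s; rewrite /= in_itv/= andbT => s0.
  have Ws := mass_gt0 nu_fin nu_gt0 s0.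
  rewrite (muleC (f s)) muleA -EFinM lee_wpmul2r ?f0// lee_fin /hardy_kernel/=.
  case: ltP => st.
    rewrite max_l ?mass_nd ?(ltW st)// -mulrA -powR_addr// opprB.
    by rewrite (_ : 1 - gam - 1 + gam = 0) ?powRr0 ?mulr1//; ring.
  rewrite max_r ?mass_nd// powRr0 mul1r -powR_addr//.
  by rewrite (_ : -1 - 0 + gam = gam - 1)//; ring.
Qed.

(** With f = g^(p/r) V^-gam the norm of f is that of g, and since g is
nonincreasing the average of f at t is at least g(t)^(p/r) times the average
of V^-gam, a multiple of V(t)^-gam. *)
Lemma decreasing_bound_of_average C r gam : 0 < C -> 1 <= r -> gam < 1 ->
  (forall f, Mplus f ->
  (rho (fun t => navg f t `^ (r / p) * (W t `^ (gam * (r / p)))%:E) <=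
   C%:E * (\int[nu]_(t in `]0%R, +oo[) (f t `^ r * (W t `^ (gam * r))%:E)) `^ p^-1)%E) ->
  exists2 C' : R, 0 < C' & decreasing_bound C'.
Proof.
move=> C0 r1 gam1 H.
have r0 : 0 < r := lt_le_trans ltr01 r1.
have rp0 : 0 < r / p by rewrite divr_gt0.
have pr0 : 0 < p / r by rewrite divr_gt0.
have b0 : 0 < 1 - gam by rewrite subr_gt0.
have [c c0 Hc] := integral_mass_powR_head_ge nu_fin nu_gt0 nu_atomless b0.
have [K K0 HK] := rho_scale.
have cq0 : 0 < c `^ (r / p) by rewrite powR_gt0.
exists (K * (c `^ (r / p))^-1 * C); first by rewrite !mulr_gt0 ?invr_gt0.
move=> g Mg gd; have [mg g0] := Mg.
pose f s := (g s `^ (p / r) * (W s `^ (- gam))%:E)%E.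
have Mf : Mplus f by exact: MplusM (Mplus_poweR _ Mg) (Mplus_mass _).
have Mu := Mplus_poweR (p / r) Mg.
pose T t := (navg f t `^ (r / p) * (W t `^ (gam * (r / p)))%:E)%E.
have MT : Mplus T by exact: MplusM (Mplus_poweR _ (Mplus_navg Mf)) (Mplus_mass _).
have gT t : 0 < t -> (g t <= ((c `^ (r / p))^-1)%:E * T t)%E.
  move=> t0; have Wt := mass_gt0 nu_fin nu_gt0 t0.
  rewrite muleC lee_pdivlMr//.
  have -> : (g t * (c `^ (r / p))%:E =
      ((g t `^ (p / r) * (c * W t `^ (- gam))%:E) * (W t `^ gam)%:E) `^ (r / p))%E.
    rewrite -muleA -EFinM -mulrA -powR_addr// addNr powRr0 mulr1.
    rewrite poweRM ?poweR_ge0 ?lee_fin ?(ltW c0)// -poweRrM.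
    by rewrite mulrA divfK ?gt_eqF// divff ?gt_eqF// poweRe1 ?g0.
  have n0 := proj2 (Mplus_navg Mf) t t0.
  rewrite /T powRrM -[X in (_ <= _ * X)%E]poweR_EFin -[leRHS]poweRM ?lee_fin ?powR_ge0//.
  apply: poweR_ler; first exact: ltW.
    by rewrite !mule_ge0 ?poweR_ge0// lee_fin ?mulr_ge0 ?powR_ge0// ltW.
  rewrite lee_wpmul2r ?lee_fin ?powR_ge0// /navg.
  apply: (@le_trans _ _ ((W t)^-1%:E * (g t `^ (p / r) * (c * W t `^ (1 - gam))%:E))%E).
    rewrite muleCA -EFinM lee_wpmul2l ?poweR_ge0// lee_fin.
    by rewrite powR_addr// powRr1 ?(ltW Wt)// le_eqVlt; apply/predU1P; left; field; rewrite gt_eqF.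
  rewrite lee_wpmul2l ?lee_fin ?invr_ge0 ?(ltW Wt)//.
  apply: (le_trans (lee_wpmul2l (poweR_ge0 _ _) (Hc t t0))).
  rewrite (Mplus_integralZl nu (measurable_itv _) (@itv0_sub _ t) (Mplus_mass _) (poweR_ge0 _ _)).
  apply: le_integral_pointwise => s; rewrite /= in_itv/= => /andP[s0 st].
  rewrite /f (addrAC 1) subrr add0r lee_wpmul2r ?lee_fin ?powR_ge0//.
  by apply: poweR_ler; [exact: ltW|exact: g0|apply: gd => //; exact: ltW].
have cV0 : 0 <= (c `^ (r / p))^-1 by rewrite invr_ge0 ltW.
apply: (le_trans (HK _ _ _ cV0 Mg MT gT)).
rewrite [in leRHS]EFinM -muleA lee_wpmul2l ?lee_fin ?mulr_ge0 ?(ltW K0)//.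
apply: (le_trans (H _ Mf)); rewrite lee_wpmul2l ?lee_fin ?(ltW C0)//.
apply: poweR_ler; first by rewrite invr_ge0 ltW.
  by apply: integral_ge0 => t _; rewrite mule_ge0 ?poweR_ge0// lee_fin powR_ge0.
apply: le_integral_pointwise => t; rewrite /= in_itv/= andbT => t0.
have Wt := mass_gt0 nu_fin nu_gt0 t0.
rewrite poweRM ?poweR_ge0 ?lee_fin ?powR_ge0// -poweRrM divfK ?gt_eqF//.
rewrite poweR_EFin -powRrM -muleA -EFinM -powR_addr// mulNr addNr powRr0 mule1//.
Qed.

(** If del <= 0 the factor V^del is itself nonincreasing; if del > 0 it can be
moved under the integral over (t, oo), where it only grows. *)
Lemma tail_bound C r del : 0 < C -> 1 <= r -> - r^-1 < del ->
  decreasing_bound C -> exists2 C' : R, 0 < C' & forall f, Mplus f ->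
  (rho (fun t => (W t `^ (del * (r / p)))%:E * ntail f t `^ (r / p)) <=
   C'%:E * (\int[nu]_(t in `]0%R, +oo[) (f t `^ r * (W t `^ (del * r))%:E)) `^ p^-1)%E.
Proof.
move=> C0 r1 delr decC.
have r0 : 0 < r := lt_le_trans ltr01 r1.
have rp0 : 0 < r / p by rewrite divr_gt0.
(* the part of the exponent del which stays outside the integral *)
pose d0 : R := Num.min del 0; have d00 : d0 <= 0 by rewrite ge_min lexx orbT.
have [] := @hardy _ nu nu_fin nu_gt0 nu_atomless r (r^-1 + 1) d0 r1.
- by rewrite ltrDl.
- by rewrite lt_min delr oppr_lt0 invr_gt0.
move=> C1 C10 H; exists (C * C1 `^ p^-1); first by rewrite mulr_gt0// powR_gt0.
move=> f Mf; have [mf f0] := Mf.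
pose J t := (\int[nu]_(s in `]t, +oo[) (f s * (W s `^ (-1 - d0 + del))%:E))%E.
pose G t := ((W t `^ d0)%:E * J t)%E.
have J0 t : 0 < t -> (0 <= J t)%E.
  move=> t0; apply: integral_ge0 => s; rewrite /= in_itv/= andbT => ts.
  by rewrite mule_ge0 ?f0 ?lee_fin ?powR_ge0// (lt_trans t0).
have G0 t : 0 < t -> (0 <= G t)%E.
  by move=> t0; rewrite mule_ge0 ?J0// lee_fin powR_ge0.
have Gd : nonincreasing_pos G.
  move=> x y x0 xy; have y0 := lt_le_trans x0 xy; apply: lee_pmul => //.
  - by rewrite lee_fin powR_ge0.
  - exact: J0.
  - have Wx := mass_gt0 nu_fin nu_gt0 x0; have Wxy := mass_nd nu_fin xy.
    have Wy := lt_le_trans Wx Wxy.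
    rewrite lee_fin -[d0]opprK ![_ `^ (- - d0)]powRN lef_pV2 ?posrE ?powR_gt0//.
    by rewrite ge0_ler_powR ?nnegrE ?oppr_ge0 ?(ltW Wx) ?(ltW Wy).
  - apply: le_integral_subset => // s; rewrite /= !in_itv/= !andbT; first exact: le_lt_trans.
    by move=> xs _; rewrite mule_ge0 ?f0 ?lee_fin ?powR_ge0// (lt_trans x0).
have MG : Mplus G by apply: Mplus_nonincreasing.
apply: (majorant_bound (ltW C0) (ltW C10) _ decC _ (Mplus_poweR (r / p) MG)).
- by apply: integral_ge0 => t _; rewrite mule_ge0 ?poweR_ge0// lee_fin powR_ge0.
- exact: MplusM (Mplus_mass _) (Mplus_poweR _ (Mplus_ntail Mf)).
- by apply: poweR_nonincreasing => //; rewrite ltW.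
- move=> t t0; have Wt := mass_gt0 nu_fin nu_gt0 t0.
  have a0 := ntail_ge0 Mf t0.
  rewrite powRrM -poweR_EFin -(poweRM _ (EFin_powR_ge0 _ _) a0).
  apply: poweR_ler; [exact: ltW|by rewrite mule_ge0 ?lee_fin ?powR_ge0|].
  have Mfw e := MplusM Mf (Mplus_mass e).
  rewrite /G /J /ntail !(Mplus_integralZl nu (measurable_itv _) (itvy_sub t0) (Mfw _) (EFin_powR_ge0 _ _)).
  apply: le_integral_pointwise => s; rewrite /= in_itv/= andbT => ts.
  have Ws := mass_gt0 nu_fin nu_gt0 (lt_trans t0 ts).
  rewrite 2!(muleCA _ (f s)) lee_wpmul2l ?f0 ?(lt_trans t0)// -!EFinM lee_fin.
  rewrite -(addrA (-1)) powR_addr// [leRHS]mulrCA [leLHS]mulrC ler_wpM2l ?powR_ge0//.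
  rewrite /d0; have [del0|del0] := leP del 0.
    by rewrite addNr powRr0 mulr1.
  rewrite powRr0 mul1r oppr0 add0r ge0_ler_powR ?nnegrE ?(ltW del0) ?(ltW Wt) ?(ltW Ws)//.
  by rewrite mass_nd// ltW.
- have Hh := H _ (proj1 (MplusM Mf (Mplus_mass del))) (proj2 (MplusM Mf (Mplus_mass del))).
  apply: le_trans (le_trans Hh _); last first.
    rewrite lee_wpmul2l ?lee_fin ?(ltW C10)//.
    apply: le_integral_pointwise => t; rewrite /= in_itv/= andbT => t0.
    by rewrite poweRM ?f0 ?lee_fin ?powR_ge0// poweR_EFin -powRrM.
  apply: le_integral_pointwise => t; rewrite /= in_itv/= andbT => t0.
  have Wt := mass_gt0 nu_fin nu_gt0 t0.
  rewrite -poweRrM divfK ?gt_eqF//; apply: poweR_ler => //; [exact: ltW|exact: G0|].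
  rewrite /G /J (Mplus_integralZl nu (measurable_itv _) (itvy_sub t0) (MplusM Mf (Mplus_mass _)) (EFin_powR_ge0 _ _)).
  apply: le_integral_subset => s.
  + by rewrite /= !in_itv/= !andbT; exact: lt_trans.
  + rewrite /= in_itv/= andbT => ts; have s0 := lt_trans t0 ts.
    have Ws := mass_gt0 nu_fin nu_gt0 s0.
    rewrite 2!(muleCA _ (f s)) lee_wpmul2l ?f0// -!EFinM lee_fin /hardy_kernel/=.
    by rewrite ltNge (ltW ts)/= -mulrA -powR_addr.
  + rewrite /= in_itv/= andbT => s0 _; rewrite !mule_ge0 ?f0 ?lee_fin ?powR_ge0//.
    exact: hardy_kernel_ge0.
Qed.

(** The test function is V^-del h, where h averages u = g^(p/r) with the weight
V / V^2. The extra power of V keeps this operator bounded on L^r for r = 1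
too, and h(s) >= c u(t) V(t)^2 / V(s)^2 for s > t; integrating up to the point
where V doubles recovers u(t). Where V cannot double, g is below a constant
[lam], and g <= lam (F + 1) with F a multiple of T f. *)
Lemma decreasing_bound_of_tail C C1 r del : 0 < C -> 0 < C1 ->
  1 <= r -> - r^-1 < del ->
  (forall f, Mplus f ->
  (rho (fun t => (W t `^ (del * (r / p)))%:E * ntail f t `^ (r / p)) <=
   C%:E * (\int[nu]_(t in `]0%R, +oo[) (f t `^ r * (W t `^ (del * r))%:E)) `^ p^-1)%E) ->
  (rho (fun=> 1) <= C1%:E * (nu `]0%R, +oo[%classic) `^ p^-1)%E ->
  exists2 C' : R, 0 < C' & decreasing_bound C'.
Proof.
move=> C0 C10 r1 delr H H1.
have r0 : 0 < r := lt_le_trans ltr01 r1.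
have ri : r^-1 <= 1 by rewrite invf_le1.
have rp0 : 0 < r / p by rewrite divr_gt0.
have pr0 : 0 < p / r by rewrite divr_gt0.
have pi0 : 0 < p^-1 by rewrite invr_gt0.
have [c c0 Hc] := integral_mass_powR_head_ge nu_fin nu_gt0 nu_atomless (ltr0Sn R 1).
(* the exponent 2 exceeds r^-1 for every r >= 1 *)
have [] := @hardy _ nu nu_fin nu_gt0 nu_atomless r 2 0 r1.
- by rewrite (le_lt_trans ri)// ltr1n.
- by rewrite oppr_lt0 invr_gt0.
move=> C2 C20 Hh.
have [K K0 HK] := rho_scale.
have [mono [K' [K'0 Kadd _]]] := rho_submonotone.
pose c' := c * 2 `^ (- (3 + del)).
have c'0 : 0 < c' by rewrite mulr_gt0// powR_gt0.
pose L := (c' `^ (r / p))^-1.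
have L0 : 0 < L by rewrite invr_gt0 powR_gt0.
pose A1 := K * L * (C * C2 `^ p^-1).
pose A2 := K * K' * (A1 + C1 * 2 `^ p^-1).
have A10 : 0 < A1 by rewrite !mulr_gt0 ?powR_gt0.
have A20 : 0 < A2 by rewrite !mulr_gt0 ?addr_gt0 ?mulr_gt0 ?powR_gt0.
exists (A1 + A2); first by rewrite addr_gt0.
move=> g Mg gd; have [mg g0] := Mg.
set N := (\int[nu]_(t in _) _)%E.
have N0 : (0 <= N)%E by apply: integral_ge0 => t _; exact: poweR_ge0.
have [Ny|Nfin] := eqVneq N +oo%E.
  by rewrite Ny poweRyr ?gt_eqF// gt0_muley ?leey// lte_fin addr_gt0.
have [n Nn] : exists n, N = n%:E.
  by exists (fine N); rewrite fineK// ge0_fin_numE// ltey.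
have n0 : 0 <= n by rewrite -lee_fin -Nn.
rewrite Nn poweR_EFin -EFinM.
pose u t := (g t `^ (p / r))%E.
have Mu : Mplus u by exact: Mplus_poweR.
have Muw := MplusM Mu (Mplus_mass 1).
pose h t := ((W t `^ (-2))%:E * \int[nu]_(s in `]0%R, t[) (u s * (W s `^ 1)%:E))%E.
have Mh : Mplus h by exact: MplusM (Mplus_mass _) (Mplus_primitive Muw).
pose f t := (h t * (W t `^ (- del))%:E)%E.
have Mf : Mplus f by exact: MplusM Mh (Mplus_mass _).
pose T t := ((W t `^ (del * (r / p)))%:E * ntail f t `^ (r / p))%E.
have MT : Mplus T by exact: MplusM (Mplus_mass _) (Mplus_poweR _ (Mplus_ntail Mf)).
have normf : (\int[nu]_(t in `]0%R, +oo[) (f t `^ r * (W t `^ (del * r))%:E) <= (C2 * n)%:E)%E.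
  rewrite EFinM -Nn.
  apply: (@le_trans _ _ (\int[nu]_(t in `]0%R, +oo[) (h t `^ r))%E).
    apply: le_integral_pointwise => t; rewrite /= in_itv/= andbT => t0.
    have Wt := mass_gt0 nu_fin nu_gt0 t0; have ht := proj2 Mh t t0.
    rewrite poweRM ?lee_fin ?powR_ge0// poweR_EFin -powRrM -muleA -EFinM -powR_addr//.
    by rewrite mulNr addNr powRr0 mule1.
  have -> : N = (\int[nu]_(t in `]0%R, +oo[) (u t `^ r))%E.
    by apply: eq_integral => t _; rewrite /u -poweRrM divfK ?gt_eqF.
  apply: le_trans (Hh _ (proj1 Mu) (proj2 Mu)).
  apply: le_integral_pointwise => t; rewrite /= in_itv/= andbT => t0.
  apply: poweR_ler; [exact: ltW|exact: (proj2 Mh)|].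
  rewrite /h (Mplus_integralZl nu (measurable_itv _) (@itv0_sub _ t) Muw (EFin_powR_ge0 _ _)).
  apply: le_integral_subset => s; rewrite /= !in_itv/=.
  - by move=> /andP[->].
  - move=> /andP[s0 st]; rewrite /hardy_kernel/= st muleCA -EFinM muleC.
    by rewrite lee_wpmul2r ?poweR_ge0// (_ : 2 - 1 = 1)//; ring.
  - rewrite andbT => s0 _; rewrite mule_ge0 ?poweR_ge0// lee_fin.
    exact: hardy_kernel_ge0.
have rhoT : (rho T <= (C * (C2 * n) `^ p^-1)%:E)%E.
  apply: (le_trans (H _ Mf)); rewrite EFinM lee_wpmul2l ?lee_fin ?(ltW C0)//.
  rewrite -poweR_EFin; apply: poweR_ler => //; first exact: ltW.
  by apply: integral_ge0 => t _; rewrite mule_ge0 ?poweR_ge0// lee_fin powR_ge0.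
have gT t : 0 < t -> ((2 * W t)%:E <= nu `]0%R, +oo[%classic)%E -> (g t <= L%:E * T t)%E.
  move=> t0 tD; have Wt := mass_gt0 nu_fin nu_gt0 t0.
  rewrite muleC lee_pdivlMr ?powR_gt0//.
  have q0 : 0 <= 3 + del by rewrite -lerBlDl sub0r ltW// (le_lt_trans _ delr)// lerN2 (le_trans ri)// ler1n.
  have nt : (u t * (c' * W t `^ (- del))%:E <= ntail f t)%E.
    apply: (@le_trans _ _ (\int[nu]_(s in `]t, +oo[)
        (u t * (c * W t `^ 2)%:E * (W s `^ (- (3 + del)))%:E))%E); last first.
      apply: le_integral_pointwise => s; rewrite /= in_itv/= andbT => ts.
      have Ws := mass_gt0 nu_fin nu_gt0 (lt_trans t0 ts).
      have -> : (W s `^ (- (3 + del)) = W s `^ (-2) * (W s `^ (- del) * W s `^ (- 1))).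
        by rewrite -!powR_addr//; congr powR; ring.
      rewrite !EFinM muleA -[leRHS]muleA lee_wpmul2r ?lee_fin ?mulr_ge0 ?powR_ge0//.
      rewrite muleC /h lee_wpmul2l ?lee_fin ?powR_ge0//.
      rewrite -EFinM; apply: (le_trans (lee_wpmul2l (poweR_ge0 _ _) (Hc t t0))).
      rewrite (Mplus_integralZl nu (measurable_itv _) (@itv0_sub _ t) (Mplus_mass _) (poweR_ge0 _ _)).
      apply: le_integral_subset => y; rewrite /= !in_itv/=.
      - by move=> /andP[-> yt]; exact: lt_trans ts.
      - move=> /andP[y0 yt]; rewrite (_ : 2 - 1 = 1); last by ring.
        rewrite lee_wpmul2r ?lee_fin ?powR_ge0//.
        by apply: poweR_ler; [exact: ltW|exact: g0|apply: gd => //; exact: ltW].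
      - by move=> /andP[y0 _] _; exact: (proj2 Muw).
    rewrite ge0_integralZl//; last 3 first.
    - exact: measurable_EFin_mass_powR.
    - by move=> s _; rewrite lee_fin powR_ge0.
    - by rewrite mule_ge0 ?poweR_ge0// lee_fin mulr_ge0 ?powR_ge0// ltW.
    apply: le_trans (lee_wpmul2l _ (integral_mass_powR_tail_ge nu_fin nu_gt0 nu_atomless q0 t0 tD)); last first.
      by rewrite mule_ge0 ?poweR_ge0// lee_fin mulr_ge0 ?powR_ge0// ltW.
    rewrite -muleA lee_wpmul2l ?poweR_ge0// -EFinM lee_fin /c'.
    have -> : W t `^ (- del) = W t `^ 2 * W t `^ (1 - (3 + del)).
      by rewrite -powR_addr//; congr powR; ring.
    by rewrite le_eqVlt; apply/predU1P; left; ring.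
  have -> : (g t * (c' `^ (r / p))%:E = ((u t * c'%:E) `^ (r / p)))%E.
    rewrite poweRM ?poweR_ge0 ?lee_fin ?(ltW c'0)// -poweRrM.
    by rewrite mulrA divfK ?gt_eqF// divff ?gt_eqF// poweRe1 ?g0.
  have t00 := ntail_ge0 Mf t0.
  rewrite /T powRrM -[X in (_ <= X * _)%E]poweR_EFin -[leRHS]poweRM ?lee_fin ?powR_ge0//.
  apply: poweR_ler; first exact: ltW.
    by rewrite mule_ge0 ?poweR_ge0// lee_fin ltW.
  apply: le_trans (lee_wpmul2l _ nt); last by rewrite lee_fin powR_ge0.
  by rewrite muleCA -EFinM mulrCA -powR_addr// subrr powRr0 mulr1.
have A1E : K * L * (C * (C2 * n) `^ p^-1) = A1 * n `^ p^-1.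
  by rewrite /A1 powRM ?(ltW C20)//; ring.
have bound1 : (forall t, 0 < t -> (g t <= L%:E * T t)%E) ->
    (rho g <= ((A1 + A2) * n `^ p^-1)%:E)%E.
  move=> gT'; apply: (le_trans (HK _ _ _ (ltW L0) Mg MT gT')).
  apply: (le_trans (lee_wpmul2l _ rhoT)); first by rewrite lee_fin mulr_ge0 ?(ltW K0) ?(ltW L0).
  by rewrite -EFinM lee_fin A1E ler_wpM2r ?powR_ge0// lerDl ltW.
have [Dy|Dfin] := eqVneq (nu `]0%R, +oo[%classic) +oo%E.
  by apply: bound1 => t t0; apply: gT => //; rewrite Dy leey.
have [X DX] : exists X, nu `]0%R, +oo[%classic = X%:E.
  by exists (fine (nu `]0%R, +oo[%classic)); rewrite fineK// ge0_fin_numE// ltey.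
have X0 : 0 < X.
  rewrite -lte_fin -DX; apply: (lt_le_trans (nu_gt0 ltr01)).
  by rewrite le_measure ?inE//; apply: subset_itvl.
(* g(t)^p V(t) is at most the integral of g^p over (0, t), and V(t) > X / 2 *)
pose lam := (2 * n / X) `^ p^-1.
have lam0 : 0 <= lam by exact: powR_ge0.
have glam t : 0 < t -> X < 2 * W t -> (g t <= lam%:E)%E.
  move=> t0 tX; have Wt := mass_gt0 nu_fin nu_gt0 t0.
  have : (g t `^ p * (W t)%:E <= n%:E)%E.
    rewrite -Nn -(massE nu_fin) -(integral_cst nu _ (g t `^ p)%E)//.
    apply: le_integral_subset => s; rewrite /= !in_itv/=.
    - by move=> /andP[->].
    - move=> /andP[s0 st]; apply: poweR_ler; [exact: ltW|exact: g0|apply: gd => //; exact: ltW].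
    - by move=> _ _; exact: poweR_ge0.
  rewrite -lee_pdivlMr// -EFinM => gn.
  have -> : g t = ((g t `^ p) `^ p^-1)%E.
    by rewrite -poweRrM divff ?gt_eqF// poweRe1 ?g0.
  rewrite /lam -poweR_EFin; apply: poweR_ler; [exact: ltW|exact: poweR_ge0|].
  apply: (le_trans gn); rewrite lee_fin ler_pdivrMr// mulrAC ler_pdivlMr//.
  by rewrite -mulrA mulrCA ler_wpM2l// ltW.
have [lam_eq0|lam_neq0] := eqVneq lam 0.
  apply: bound1 => t t0; have [tX|tX] := leP (2 * W t) X.
    by apply: gT => //; rewrite DX lee_fin.
  apply: (le_trans (glam t t0 tX)); rewrite lam_eq0.
  by rewrite mule_ge0 ?lee_fin ?(ltW L0)//; exact: (proj2 MT).
have lam_gt0 : 0 < lam by rewrite lt_neqAle eq_sym lam_neq0.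
pose F t := ((L / lam)%:E * T t)%E.
have Llam : 0 <= L / lam by rewrite divr_ge0// ltW.
have MF : Mplus F by exact: MplusM (Mplus_cst Llam) MT.
have MF1 : Mplus (fun t => F t + 1)%E.
  split; last by move=> t t0; rewrite adde_ge0//; exact: (proj2 MF).
  by apply: emeasurable_funD => //; exact: (proj1 MF).
have gF t : 0 < t -> (g t <= lam%:E * (F t + 1))%E.
  move=> t0; have Ft := proj2 MF t t0; have Tt := proj2 MT t t0.
  rewrite ge0_muleDr// mule1 /F muleA -EFinM mulrCA divff// mulr1.
  have [tX|tX] := leP (2 * W t) X.
    apply: (le_trans (gT t t0 _)); first by rewrite DX lee_fin.
    by rewrite leeDl ?lee_fin.
  apply: (le_trans (glam t t0 tX)).
  by rewrite leeDr// mule_ge0 ?lee_fin ?(ltW L0).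
have rho1 : (rho (fun=> 1) <= (C1 * X `^ p^-1)%:E)%E.
  by rewrite EFinM -poweR_EFin -DX.
apply: (le_trans (HK _ _ _ lam0 Mg MF1 gF)).
have rho1y : (rho (fun=> 1) < +oo)%E by rewrite (le_lt_trans rho1)// ltry.
apply: (le_trans (lee_wpmul2l _ (Kadd rho1y _ MF))); first by rewrite lee_fin mulr_ge0 ?(ltW K0).
have rhoF : (rho F <= (K * (L / lam) * (C * (C2 * n) `^ p^-1))%:E)%E.
  apply: (le_trans (HK _ _ T Llam MF MT _)) => //.
  by rewrite [leRHS]EFinM lee_wpmul2l// lee_fin mulr_ge0 ?(ltW K0).
have KK : 0 <= K * lam by rewrite mulr_ge0// ltW.
apply: (@le_trans _ _ ((K * lam)%:E * (K'%:E *
   ((K * (L / lam) * (C * (C2 * n) `^ p^-1))%:E + (C1 * X `^ p^-1)%:E)))%E).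
  by rewrite lee_wpmul2l ?lee_fin// lee_wpmul2l ?lee_fin ?(ltW K'0)// leeD.
rewrite -EFinD -!EFinM lee_fin.
apply: (@le_trans _ _ (A2 * n `^ p^-1)); last by rewrite ler_wpM2r ?powR_ge0// lerDr ltW.
have lamX : lam * X `^ p^-1 = 2 `^ p^-1 * n `^ p^-1.
  by rewrite /lam -!powRM ?(ltW X0) ?divr_ge0 ?mulr_ge0 ?(ltW X0)// divfK ?gt_eqF.
have -> : K * (L / lam) * (C * (C2 * n) `^ p^-1) = A1 * n `^ p^-1 / lam.
  by rewrite -A1E; ring.
rewrite le_eqVlt; apply/predU1P; left.
transitivity (K * K' * (A1 * n `^ p^-1 * (lam / lam) + C1 * (lam * X `^ p^-1))).
  by ring.
by rewrite divff// lamX /A2; ring.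
Qed.

End decreasing_functions.

(** * Functions with supporting lines *)

Lemma pinv_notin (T U : Type) (dflt : U -> T) (A : set T) (f : T -> U) y :
  ~ (f @` A) y -> 'pinv_dflt A f y = dflt y.
Proof.
move=> H; pose S : set_surj A (f @` A) f := fun _ => id.
rewrite /pinv_ splitV/= -[X in odflt _ X]/('oinv_S y) oinv_surj.
by case: pselect.
Qed.

Section supported.
Context (R : realType).
Implicit Types psi : R -> R.

(** Only the supporting lines of a concave function are ever used; stating
them directly makes the cases of the logarithm and of negative powers
immediate. *)
Definition supported psi :=
  (forall a, 0 < a -> exists2 c, 0 <= c &
     forall x, 0 < x -> psi x <= psi a + c * (x - a)) /\
  {in `]0, +oo[%R &, {homo psi : x y / x < y}}.

Lemma supported_lt psi x y : supported psi -> 0 < x -> x < y -> psi x < psi y.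
Proof.
move=> [_ I] x0 xy; apply: I => //; rewrite in_itv/= andbT//.
exact: lt_trans xy.
Qed.

Lemma supported_le psi x y : supported psi -> 0 < x -> 0 < y -> (psi x <= psi y) = (x <= y).
Proof.
move=> S x0 y0; have [xy|yx] := leP x y; last first.
  by apply/negbTE; rewrite -ltNge; exact: supported_lt.
move: xy; rewrite le_eqVlt => /predU1P[->|xy]; first exact: lexx.
by rewrite ltW// supported_lt.
Qed.

(** The slopes of the supporting lines decrease, so to the right of [a] they
are bounded by the slope at [a / 2]. *)
Lemma supported_lipschitz psi a : supported psi -> 0 < a -> exists2 c, 0 <= c &
  forall x y, a <= x -> x <= y -> psi y <= psi x + c * (y - x).
Proof.
move=> [S _] a0; have a20 : 0 < a / 2 by rewrite divr_gt0.
have [c c0 Hc] := S _ a20; exists c => // x y ax xy.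
have x0 : 0 < x := lt_le_trans a0 ax.
have [cx cx0 Hcx] := S _ x0.
apply: (le_trans (Hcx _ (lt_le_trans x0 xy))); rewrite lerD2l.
rewrite ler_wpM2r ?subr_ge0//.
have ax2 : 0 < x - a / 2 by rewrite subr_gt0 (lt_le_trans _ ax)// ltr_pdivrMr// ltr_pMr// ltr1n.
rewrite -(ler_pM2r ax2).
have := Hcx _ a20; have := Hc _ x0; lra.
Qed.

Lemma supported_IVT psi a b y : supported psi -> 0 < a -> a <= b ->
  psi a <= y -> y <= psi b -> exists x, [/\ a <= x, x <= b & psi x = y].
Proof.
move=> S a0 ab ay yb; have [c c0 Hc] := supported_lipschitz S a0.
(* the largest point of the sublevel set of level y, by completeness *)
pose E := [set x | a <= x <= b /\ psi x <= y].
have Ea : E a by split; rewrite ?lexx.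
have supE : has_sup E by split; [exists a|exists b => x [/andP[]]].
set s := sup E.
have as_ : a <= s by apply: ub_le_sup => //; exact: (proj2 supE).
have sb : s <= b by apply: ge_sup; [exists a|move=> x [/andP[]]].
exists s; split => //; apply/eqP; rewrite eq_le; apply/andP; split.
  apply/ler_addgt0Pr => e e0.
  have e'0 : 0 < e / (c + 1) by rewrite divr_gt0// ltr_wpDl.
  have [u [/andP[au ub] uy] su] := sup_adherent e'0 supE.
  have us : u <= s by apply: ub_le_sup; [exact: (proj2 supE)|split; rewrite ?au].
  apply: (le_trans (Hc _ _ au us)); apply: lerD => //.
  apply: (@le_trans _ _ (c * (e / (c + 1)))); first by rewrite ler_wpM2l//; move: su; rewrite -/s; lra.
  by rewrite mulrCA ler_piMr ?(ltW e0)// ler_pdivrMr ?mul1r ?lerDl// ltr_wpDl.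
rewrite leNgt; apply/negP => psy.
have sltb : s < b.
  rewrite lt_neqAle sb andbT; apply/eqP => sbE.
  by move: psy; rewrite sbE ltNge yb.
pose d := Num.min (b - s) ((y - psi s) / (c + 1)).
have c10 : 0 < c + 1 by rewrite ltr_wpDl.
have d0 : 0 < d by rewrite lt_min subr_gt0 sltb divr_gt0// subr_gt0.
suff : E (s + d) by move=> /(ub_le_sup (proj2 supE)); rewrite -/s gerDl leNgt d0.
split.
  rewrite (le_trans as_) ?lerDl ?(ltW d0)//= -lerBrDl; first by rewrite ge_min lexx.
have sd : s <= s + d by rewrite lerDl ltW.
apply: (le_trans (Hc _ _ as_ sd)); rewrite (addrC s) addrK -lerBrDl.
apply: (@le_trans _ _ (c * ((y - psi s) / (c + 1)))).
  by rewrite ler_wpM2l// ge_min lexx orbT.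
by rewrite mulrCA ler_piMr ?subr_ge0 ?(ltW psy)// ler_pdivrMr ?mul1r ?lerDl.
Qed.

Lemma einverse_in psi x : supported psi -> 0 < x -> einverse psi (psi x)%:E = x%:E.
Proof.
move=> S x0; rewrite /einverse pinvKV//; last by rewrite inE/= in_itv/= x0.
move=> u v; rewrite !inE/= !in_itv/= !andbT => u0 v0 uv.
by apply/eqP; rewrite eq_le -(supported_le S u0 v0) -(supported_le S v0 u0) uv lexx.
Qed.

Lemma einverse_notin psi y : ~ (exists2 x, 0 < x & psi x = y) -> einverse psi y%:E = 0%E.
Proof.
move=> H; rewrite /einverse pinv_notin// => -[x]; rewrite /= in_itv/= andbT => x0 xy.
by apply: H; exists x.
Qed.

Lemma einverse_ge0 psi y : supported psi -> (0 <= einverse psi y)%E.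
Proof.
move=> S; case: y => [y| |]//; have [[x x0 <-]|/einverse_notin ->//] := pselect (exists2 x, 0 < x & psi x = y).
by rewrite einverse_in// lee_fin ltW.
Qed.

Lemma einverse_le psi y a : supported psi -> 0 < a -> (y <= (psi a)%:E)%E ->
  (einverse psi y <= a%:E)%E.
Proof.
move=> S a0; case: y => [y||_]; [|by rewrite leye_eq|by rewrite lee_fin ltW].
have [[x x0 <-]|/einverse_notin ->] := pselect (exists2 x, 0 < x & psi x = y).
  by rewrite einverse_in// !lee_fin supported_le.
by move=> _; rewrite lee_fin ltW.
Qed.

(** A superlevel set of positive level is the image by [psi] of a half-line, an
interval by the intermediate value property. *)
Lemma measurable_einverse psi : supported psi -> measurable_fun setT (einverse psi).
Proof.
move=> S; apply: (measurability _ (ErealGenCInfty.measurableE R)) => /= _ [_ [r ->] <-].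
rewrite setTI; have [r0|r0] := leP r 0.
  rewrite (_ : _ @^-1` _ = setT)//; apply/seteqP; split => // y _ /=.
  by rewrite in_itv/= andbT (le_trans _ (einverse_ge0 _ S)).
pose J : set R := [set y | exists2 x, r <= x & psi x = y].
rewrite (_ : _ @^-1` _ = EFin @` J).
  apply: measurable_image_EFin; apply: is_interval_measurable.
  move=> _ _ [x1 r1 <-] [x2 r2 <-] z /andP[z1 z2].
  have x10 := lt_le_trans r0 r1; have x20 := lt_le_trans r0 r2.
  have x12 : x1 <= x2 by rewrite -(supported_le S)// (le_trans z1).
  have [x [x1x _ <-]] := supported_IVT S x10 x12 z1 z2.
  by exists x => //; exact: le_trans x1x.
apply/seteqP; split => [y|_ [_ [x rx <-] <-]]; rewrite /preimage /mkset.
  rewrite in_itv/= andbT; case: y => [y| |].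
  - have [[x x0 <-]|/einverse_notin ->] := pselect (exists2 x, 0 < x & psi x = y).
      by rewrite einverse_in// lee_fin => rx; exists (psi x) => //; exists x.
    by rewrite lee_fin leNgt r0.
  - by rewrite lee_fin leNgt r0.
  - by rewrite lee_fin leNgt r0.
by rewrite in_itv andbT einverse_in ?lee_fin// (lt_le_trans r0).
Qed.

End supported.

Section supported_examples.
Context (R : realType).
Implicit Types psi : R -> R.

Lemma concave_comb psi x y t : @convex_function R R^o `]0, +oo[ (\- psi) ->
  0 < x -> 0 < y -> 0 <= t <= 1 ->
  t * psi x + (1 - t) * psi y <= psi (t * x + (1 - t) * y).
Proof.
move=> cvx x0 y0 /andP[t0 t1].
have := cvx (Itv01 t0 t1) x y; rewrite !inE/= !in_itv/= !andbT => /(_ x0 y0).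
rewrite !convRE/= => H.
move: H; rewrite !mulrN -opprD lerN2; exact.
Qed.

(** The slope of a supporting line at [a] is the supremum of the slopes of
chords issued from [a] to the right, finite by comparison with any chord to
the left. *)
Lemma concave_supported psi : @convex_function R R^o `]0, +oo[ (\- psi) ->
  {in `]0, +oo[%R &, {homo psi : x y / x < y}} -> supported psi.
Proof.
move=> cvx incr; split => // a a0.
pose sl y := (psi y - psi a) / (y - a).
have slopes x y : 0 < x -> x < a -> a < y -> sl y <= (psi a - psi x) / (a - x).
  move=> x0 xa ay.
  have xy : 0 < y - x by rewrite subr_gt0 (lt_trans xa).
  (* a is the barycenter of x and y with weights t and 1 - t *)
  pose t := (y - a) / (y - x).
  have t01 : 0 <= t <= 1.
    rewrite divr_ge0 ?subr_ge0 ?(ltW ay) ?(ltW (lt_trans xa ay))//=.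
    by rewrite ler_pdivrMr// mul1r lerD2l lerN2 ltW.
  have := concave_comb cvx x0 (lt_trans a0 ay) t01.
  have -> : t * x + (1 - t) * y = a by rewrite /t; field; rewrite gt_eqF.
  have -> : t * psi x + (1 - t) * psi y =
      ((y - a) * psi x + (a - x) * psi y) / (y - x).
    by rewrite /t; field; rewrite gt_eqF.
  rewrite ler_pdivrMr// => H.
  rewrite /sl ler_pdivrMr ?subr_gt0// mulrAC ler_pdivlMr ?subr_gt0//.
  by move: H; lra.
have a20 : 0 < a / 2 by rewrite divr_gt0.
have a2a : a / 2 < a by rewrite ltr_pdivrMr// ltr_pMr// ltr1n.
pose E := sl @` [set y | a < y].
have E0 : E (sl (a + 1)) by exists (a + 1) => //=; rewrite ltrDl.
have supE : has_sup E.
  split; first by exists (sl (a + 1)).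
  exists ((psi a - psi (a / 2)) / (a - a / 2)) => _ [y ay <-].
  exact: slopes.
have inc x y : 0 < x -> x < y -> psi x < psi y.
  move=> x0 xy; apply: incr => //; rewrite in_itv/= andbT//.
  exact: lt_trans xy.
exists (sup E).
  apply: le_trans (ub_le_sup (proj2 supE) E0).
  by rewrite divr_ge0 ?subr_ge0 ?ltW ?inc ?ltrDl.
move=> x x0; have [xa|ax|->] := ltgtP x a; last by rewrite subrr mulr0 addr0.
  have : sup E <= (psi a - psi x) / (a - x).
    by apply: ge_sup; [exists (sl (a + 1))|move=> _ [y ay <-]; exact: slopes].
  by rewrite ler_pdivlMr ?subr_gt0//; lra.
have : sl x <= sup E by apply: ub_le_sup; [exact: (proj2 supE)|exists x].
by rewrite /sl ler_pdivrMr ?subr_gt0//; lra.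
Qed.

Lemma admissible_supported (phi : R -> R) : admissible phi ->
  supported phi \/ supported (\- phi).
Proof.
case=> -[cvx mon]; [left|right]; apply: concave_supported => //.
  by rewrite (_ : \- (\- phi) = phi)//; apply/funext => x /=; rewrite opprK.
by move=> x y x0 y0 xy /=; rewrite ltrN2 mon.
Qed.

Lemma ln_le_affine (a x : R) : 0 < a -> 0 < x -> ln x <= ln a + a^-1 * (x - a).
Proof.
move=> a0 x0; have xa : 0 < x / a by rewrite divr_gt0.
rewrite -lerBlDl -ln_div ?posrE// mulrBr mulVf ?gt_eqF//.
rewrite [a^-1 * x]mulrC; have := @le_ln1Dx R (x / a - 1); rewrite (addrC 1) subrK; apply.
by rewrite ltrBrDl addrN.
Qed.

Lemma ln_supported : supported (@ln R).
Proof.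
split.
  move=> a a0; exists a^-1; first by rewrite invr_ge0 ltW.
  by move=> x; exact: ln_le_affine.
by move=> x y; rewrite !in_itv/= !andbT => x0 y0 xy; rewrite ltr_ln.
Qed.

(** The bound X >= A (1 + ln (X / A)) for X = x^-q and A = a^-q reduces the
claim to the supporting line of the logarithm. *)
Lemma powRN_supported q : 0 < q -> supported (fun x : R => - (x `^ (- q))).
Proof.
move=> q0; split.
  move=> a a0; have aq : 0 < a `^ (- q) by rewrite powR_gt0.
  exists (a `^ (- q) * (q / a)); first by rewrite mulr_ge0 ?divr_ge0 ?ltW.
  move=> x x0; have xq : 0 < x `^ (- q) by rewrite powR_gt0.
  have := ln_le_affine aq xq; rewrite !ln_powR.
  have := ln_le_affine a0 x0.
  set lx := ln x; set la := ln a; set X := x `^ (- q); set A := a `^ (- q).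
  move=> h1 h2.
  have h3 : q * lx <= q * (la + a^-1 * (x - a)) by rewrite ler_pM2l.
  have h4 : - (q * (a^-1 * (x - a))) <= A^-1 * (X - A) by move: h3 h2; lra.
  have h5 : A * - (q * (a^-1 * (x - a))) <= A * (A^-1 * (X - A)) by rewrite ler_pM2l.
  have AX : A * (A^-1 * (X - A)) = X - A by rewrite mulrA divff ?gt_eqF// mul1r.
  by move: h5; rewrite AX; lra.
move=> x y; rewrite !in_itv/= !andbT => x0 y0 xy; rewrite ltrN2 !powRN.
by rewrite ltf_pV2 ?posrE ?powR_gt0// gt0_ltr_powR ?nnegrE// ltW.
Qed.

End supported_examples.

(** * Quasi-arithmetic means *)

Section means.
Context (R : realType) (nu : {sigma_finite_measure set (measurableTypeR R) -> \bar R}).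
Hypothesis nu_fin : forall t, 0 < t -> (nu `]0%R, t[%classic < +oo)%E.
Hypothesis nu_gt0 : forall t, 0 < t -> (0 < nu `]0%R, t[%classic)%E.
Hypothesis nu_atomless : forall t, nu [set t] = 0%E.
Context (rho : (R -> \bar R) -> \bar R) (p : R).
Hypothesis rho_submonotone : submonotone rho.
Hypothesis p_gt1 : 1 < p.
Context (psi : R -> R).
Hypothesis psiS : supported psi.

Notation W := (mass nu).
Notation lnorm f := ((\int[nu]_(t in `]0%R, +oo[) ((f t `^ p)%R%:E)) `^ p^-1)%E.

Let p0 : 0 < p. Proof. exact: lt_trans p_gt1. Qed.

(** The quasi-arithmetic mean of [f] over (0, t) generated by [psi]. *)
Definition qmean (f : R -> R) t := einverse psi (navg nu (fun s => (psi (f s))%:E) t).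

Lemma positive_mfun_Mplus (f : R -> R) : positive_mfun f -> Mplus (fun t => (f t)%:E).
Proof.
move=> [mf f0]; split; last by move=> t t0; rewrite lee_fin ltW// f0.
exact/measurable_EFinP.
Qed.

Lemma measurable_psi (f : R -> R) : positive_mfun f ->
  measurable_fun (`]0, +oo[ : set R) (fun s => (psi (f s))%:E).
Proof.
move=> [mf f0].
have mpsi : measurable_fun (`]0, +oo[ : set R) (fun s => (psi s)%:E).
  apply: nondecreasing_measurable_fun => x y x0 xy.
  by rewrite lee_fin supported_le// (lt_le_trans x0).
apply: (@measurable_comp _ _ _ _ _ _ (`]0, +oo[ : set R) (fun s => (psi s)%:E)) => //.
move=> _ [s + <-]; rewrite /= !in_itv/= !andbT; exact: f0.
Qed.

(** The positive and the negative part have monotone primitives, so no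
integrability of [F] is needed. *)
Lemma measurable_navg_signed (F : R -> \bar R) : measurable_fun (`]0, +oo[ : set R) F ->
  measurable_fun (`]0, +oo[ : set R) (navg nu F).
Proof.
move=> mF.
have Mpos : Mplus F^\+%E.
  by split=> [|t _]; [exact: measurable_funepos|exact: funepos_ge0].
have Mneg : Mplus F^\-%E.
  by split=> [|t _]; [exact: measurable_funeneg|exact: funeneg_ge0].
apply: (eq_measurable_fun (fun t => (W t `^ (-1))%:E *
   (\int[nu]_(s in `]0%R, t[) F^\+ s - \int[nu]_(s in `]0%R, t[) F^\- s))%E).
  move=> t; rewrite inE/= in_itv/= andbT => t0.
  by rewrite /navg [in RHS]integralE powR_inv1// ltW// mass_gt0.
apply: emeasurable_funM; first exact: measurable_EFin_mass_powR.
by apply: emeasurable_funB; [exact: (proj1 (Mplus_primitive nu Mpos))|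
  exact: (proj1 (Mplus_primitive nu Mneg))].
Qed.

Lemma Mplus_qmean (f : R -> R) : positive_mfun f -> Mplus (qmean f).
Proof.
move=> Pf; split; last by move=> t _; exact: einverse_ge0.
apply: (measurableT_comp (measurable_einverse psiS)).
exact: measurable_navg_signed (measurable_psi Pf).
Qed.

Lemma integral_lt_fin (f : R -> R) t : positive_mfun f -> 0 < t ->
  (\int[nu]_(t in `]0%R, +oo[) ((f t `^ p)%R%:E) < +oo)%E ->
  (\int[nu]_(s in `]0%R, t[) (f s)%:E < +oo)%E.
Proof.
move=> Pf t0 Nf; have [mf f0] := Pf.
have sub := @itv0_sub R t.
have Mp : Mplus (fun s => (f s `^ p)%:E).
  by apply: eq_Mplus (Mplus_poweR p (positive_mfun_Mplus Pf)) _.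
apply: (@le_lt_trans _ _ (\int[nu]_(s in `]0%R, t[) (1%:E + (f s `^ p)%:E))%E).
  apply: le_integral_pointwise => s; rewrite /= in_itv/= => /andP[s0 _].
  have := @le_add_poweR R 1 p (f s)%:E ltr01 (ltW p_gt1).
  rewrite lee_fin => /(_ (ltW (f0 _ s0))).
  by rewrite (congr1 (@^~ (1 - p)) (powR1 R))/= mul1e.
rewrite ge0_integralD//; last first.
- exact: (measurable_funS _ sub (proj1 Mp)).
- by move=> s _; rewrite lee_fin powR_ge0.
rewrite (integral_cst nu _ 1%:E)// mul1e (massE nu_fin) lte_add_pinfty ?ltry//.
apply: le_lt_trans Nf; apply: le_integral_subset => // s.
by rewrite lee_fin powR_ge0.
Qed.

(** Integrating the supporting line at the average [a] of [f]. The average of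
psi o f may be -oo, and then the bound is void of content but true. *)
Lemma jensen (f : R -> R) t : positive_mfun f -> 0 < t ->
  (\int[nu]_(s in `]0%R, t[) (f s)%:E < +oo)%E ->
  exists a, [/\ 0 < a, navg nu (fun s => (f s)%:E) t = a%:E &
    (navg nu (fun s => (psi (f s))%:E) t <= (psi a)%:E)%E].
Proof.
move=> Pf t0 If; have [mf f0] := Pf; have Wt := mass_gt0 nu_fin nu_gt0 t0.
have sub := @itv0_sub R t.
have f0' s : `]0, t[%classic s -> 0 < f s.
  by rewrite /= in_itv/= => /andP[s0 _]; exact: f0.
have mfE : measurable_fun (`]0, t[ : set R) (fun s => (f s)%:E).
  by apply: (measurable_funS _ sub) => //; exact/measurable_EFinP.
have I0 : (0 < \int[nu]_(s in `]0%R, t[) (f s)%:E)%E.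
  exact: (integral_pos _ _ _ (nu_gt0 t0)).
have [m Im] : exists m, (\int[nu]_(s in `]0%R, t[) (f s)%:E = m%:E)%E.
  by exists (fine (\int[nu]_(s in `]0%R, t[) (f s)%:E)); rewrite fineK// ge0_fin_numE// ltW.
have m0 : 0 < m by rewrite -lte_fin -Im.
pose a := (W t)^-1 * m.
have a0 : 0 < a by rewrite mulr_gt0// invr_gt0.
exists a; split => //; first by rewrite /navg Im.
have [c c0 Hc] := proj1 psiS _ a0.
have intf : nu.-integrable `]0, t[ (fun s => (f s)%:E).
  apply/integrableP; split => //.
  apply: le_lt_trans If; apply: le_integral_pointwise => s /f0' fs.
  by rewrite /= gtr0_norm.
have intc k : nu.-integrable `]0, t[ (fun _ => k%:E).
  apply/integrableP; split => //.
  by rewrite /= (integral_cst nu _ `|k|%:E)// (massE nu_fin) -EFinM ltry.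
apply: (@le_trans _ _ ((W t)^-1%:E *
   \int[nu]_(s in `]0%R, t[) ((psi a - c * a)%:E + c%:E * (f s)%:E))%E).
  rewrite lee_wpmul2l ?lee_fin ?invr_ge0 ?(ltW Wt)//.
  apply: le_integral_pointwise => s /f0' fs; rewrite -EFinM -EFinD lee_fin.
  by have := Hc _ fs; lra.
rewrite integralD//; last exact: integrableZl.
rewrite (integral_cst nu _ (psi a - c * a)%:E)// integralZl// Im (massE nu_fin).
rewrite -!EFinM lee_fin le_eqVlt; apply/predU1P; left.
by rewrite /a; field; rewrite gt_eqF.
Qed.

Lemma qmean_le_navg (f : R -> R) t : positive_mfun f -> 0 < t ->
  (\int[nu]_(s in `]0%R, t[) (f s)%:E < +oo)%E ->
  (qmean f t <= navg nu (fun s => (f s)%:E) t)%E.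
Proof.
by move=> Pf t0 /(jensen Pf t0)[a [a0 -> le_a]]; exact: einverse_le.
Qed.

(** The average of psi o g lies between psi (g t), because g is nonincreasing,
and psi a, by Jensen's inequality; hence it is in the range of [psi]. *)
Lemma qmean_ge (g : R -> R) t : positive_mfun g -> 0 < t ->
  (forall x y : R, 0 < x -> x <= y -> g y <= g x) ->
  (\int[nu]_(s in `]0%R, t[) (g s)%:E < +oo)%E ->
  ((g t)%:E <= qmean g t)%E.
Proof.
move=> Pg t0 gd /(jensen Pg t0)[a [a0 _ le_a]]; have g0 := proj2 Pg.
have Wt := mass_gt0 nu_fin nu_gt0 t0.
have ge_g : ((psi (g t))%:E <= navg nu (fun s => (psi (g s))%:E) t)%E.
  apply: (@le_trans _ _ ((W t)^-1%:E * \int[nu]_(s in `]0%R, t[) (psi (g t))%:E)%E).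
    rewrite (integral_cst nu _ (psi (g t))%:E)// (massE nu_fin) -!EFinM lee_fin.
    by rewrite mulrCA mulVf ?mulr1// gt_eqF.
  rewrite lee_wpmul2l ?lee_fin ?invr_ge0 ?(ltW Wt)//.
  apply: le_integral_pointwise => s; rewrite /= in_itv/= => /andP[s0 st].
  by rewrite lee_fin supported_le ?g0// gd// ltW.
rewrite /qmean; move: le_a ge_g; case: (navg _ _ _) => [y| |]; rewrite ?leye_eq ?leeNy_eq//.
rewrite !lee_fin => ya gy.
have gta : g t <= a by rewrite -(supported_le psiS) ?g0// (le_trans gy).
have [x [gx _ <-]] := supported_IVT psiS (g0 _ t0) gta gy ya.
have x0 := lt_le_trans (g0 _ t0) gx.
by rewrite -lee_fin; have := einverse_in psiS x0 => /= ->; rewrite lee_fin.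
Qed.

(** The mean is dominated by the plain average, which corresponds to the
exponents r = p and gam = 0. *)
Lemma qmean_bound C : 0 < C -> decreasing_bound nu rho p C ->
  exists2 C' : R, 0 < C' & forall f, positive_mfun f ->
    (rho (qmean f) <= C'%:E * lnorm f)%E.
Proof.
move=> C0 decC.
have gam : 0 < 1 - p^-1 :> R by rewrite subr_gt0 invf_lt1.
have [C' C'0 HC'] := average_bound nu_fin nu_gt0 nu_atomless rho_submonotone p_gt1 C0 (ltW p_gt1) gam decC.
exists C' => // f Pf; have Mf := positive_mfun_Mplus Pf.
set N := (\int[nu]_(t in _) _)%E.
have N0 : (0 <= N)%E by apply: integral_ge0 => t _; rewrite lee_fin powR_ge0.
have [Ny|Nfin] := eqVneq N +oo%E.
  by rewrite Ny poweRyr ?invr_neq0 ?gt_eqF// gt0_muley ?leey// lte_fin.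
have Nlt : (N < +oo)%E by rewrite ltey.
have Mn := Mplus_navg nu_fin nu_gt0 Mf.
apply: (@le_trans _ _ (rho (navg nu (fun s => (f s)%:E)))).
  apply: (proj1 rho_submonotone) => //; first exact: Mplus_qmean.
  by move=> t t0; apply: qmean_le_navg => //; exact: integral_lt_fin.
rewrite (rho_ext rho_submonotone Mn
    (g := fun t => navg nu (fun s => (f s)%:E) t `^ (p / p) * (W t `^ (0 * (p / p)))%:E)%E).
  apply: (le_trans (HC' _ Mf)); rewrite lee_wpmul2l ?lee_fin ?(ltW C'0)//.
  rewrite le_eqVlt; apply/predU1P; left; congr (_ `^ _)%E.
  by apply: eq_integral => t _; rewrite mul0r powRr0 mule1.
move=> t t0; rewrite mul0r powRr0 mule1 divff ?gt_eqF// poweRe1//.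
exact: (proj2 Mn).
Qed.

(** Truncating 1 / V near 0 gives a positive nonincreasing function with finite
norm because p > 1. *)
Lemma small_positive_nonincreasing : exists h : R -> R, exists M : R,
  [/\ forall t, 0 < t -> 0 < h t, forall x y, 0 < x -> x <= y -> h y <= h x &
   (\int[nu]_(t in `]0%R, +oo[) (h t `^ p)%:E <= M%:E)%E].
Proof.
have W1 := mass_gt0 nu_fin nu_gt0 ltr01.
pose h t := Num.max (W 1) (W t) `^ (-1).
have m0 t : 0 < Num.max (W 1) (W t) by rewrite lt_max W1.
have hp t : h t `^ p = Num.max (W 1) (W t) `^ (- p).
  by rewrite /h -powRrM mulN1r.
have hd x y : 0 < x -> x <= y -> h y <= h x.
  move=> x0 xy; rewrite /h !powR_inv1 ?(ltW (m0 _))// lef_pV2 ?posrE//.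
  by rewrite ge_max !le_max (mass_nd nu_fin xy) lexx orbT.
exists h, (W 1 `^ (- p) * W 1 + powC (p - 1) * W 1 `^ (- (p - 1))); split => //.
  by move=> t _; rewrite powR_gt0.
rewrite (@integral_itv0y_split R nu true 1)//; last 2 first.
- apply/measurable_EFinP.
  apply: (@measurableT_comp _ _ _ _ _ _ (@powR R ^~ p)) => //.
  by apply/measurable_EFinP; apply: nonincreasing_measurable_fun => x y x0 xy; rewrite lee_fin hd.
- by move=> s _; rewrite lee_fin powR_ge0.
rewrite EFinD; apply: leeD.
  rewrite EFinM -(massE nu_fin) -(integral_cst nu _ (W 1 `^ (- p))%:E)//.
  apply: le_integral_pointwise => s; rewrite /= in_itv/= => /andP[s0 s1].
  by rewrite hp max_l// mass_nd// ltW.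
have p10 : 0 < p - 1 by rewrite subr_gt0.
apply: le_trans (integral_mass_powR_tail nu_fin nu_gt0 nu_atomless p10 ltr01).
apply: le_integral_pointwise => s; rewrite /= in_itv/= andbT => s1.
rewrite hp max_r ?mass_nd// lee_fin le_eqVlt; apply/predU1P; left.
by congr powR; ring.
Qed.

(** The mean inequality only accepts functions with positive real values,
whereas g may vanish. It is applied to max(g, e h) with h a positive
nonincreasing function and e so small that the norm does not exceed twice the
norm of g. If that norm is zero then g = 0 and rho g = 0 by homogeneity. *)
Lemma decreasing_bound_of_qmean C : 0 < C ->
  (forall f, positive_mfun f -> (rho (qmean f) <= C%:E * lnorm f)%E) ->
  exists2 C' : R, 0 < C' & decreasing_bound nu rho p C'.
Proof.
move=> C0 H; have pi0 : 0 < p^-1 by rewrite invr_gt0.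
exists (C * 2 `^ p^-1); first by rewrite mulr_gt0// powR_gt0.
move=> g Mg gd; have [mg g0] := Mg.
set N := (\int[nu]_(t in _) _)%E.
have N0 : (0 <= N)%E by apply: integral_ge0 => t _; exact: poweR_ge0.
have [Ny|Nfin] := eqVneq N +oo%E.
  by rewrite Ny poweRyr ?gt_eqF// gt0_muley ?leey// lte_fin mulr_gt0// powR_gt0.
have [n Nn] : exists n, N = n%:E.
  by exists (fine N); rewrite fineK// ge0_fin_numE// ltey.
have n0 : 0 <= n by rewrite -lee_fin -Nn.
have gN t : 0 < t -> (g t `^ p * (W t)%:E <= n%:E)%E.
  move=> t0; rewrite -Nn -(massE nu_fin) -(integral_cst nu _ (g t `^ p)%E)//.
  apply: le_integral_subset => s; rewrite /= !in_itv/=.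
  - by move=> /andP[->].
  - move=> /andP[s0 st]; apply: poweR_ler; [exact: ltW|exact: g0|apply: gd => //; exact: ltW].
  - by move=> _ _; exact: poweR_ge0.
have [n_eq0|n_neq0] := eqVneq n 0.
  have [K K0 HK] := rho_scale rho_submonotone.
  apply: le_trans (HK 0 g g (lexx _) Mg Mg _) _; last first.
    by rewrite mulr0 mul0e mule_ge0 ?poweR_ge0// lee_fin mulr_ge0 ?powR_ge0// ltW.
  move=> t t0; rewrite mul0e; have := gN t t0; rewrite n_eq0.
  rewrite -lee_pdivlMr ?mass_gt0// mul0e => gp0.
  have : (g t `^ p == 0)%E by rewrite eq_le gp0 poweR_ge0.
  by rewrite poweR_eq0 ?g0// => /andP[/eqP ->].
have n_gt0 : 0 < n by rewrite lt_neqAle eq_sym n_neq0.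
have gfin t : 0 < t -> g t = (fine (g t))%:E.
  move=> t0; rewrite fineK// ge0_fin_numE ?g0//.
  have := gN t t0; rewrite -lee_pdivlMr ?mass_gt0// -EFinM => gp.
  apply: (@lty_poweRy _ _ p); first by rewrite gt_eqF.
  by rewrite (le_lt_trans gp) ?ltry.
have [h [M [h0 hd hM]]] := small_positive_nonincreasing.
have M0 : 0 <= M.
  by rewrite -lee_fin; apply: le_trans hM; apply: integral_ge0 => t _; rewrite lee_fin powR_ge0.
pose e := (n / (M + 1)) `^ p^-1.
have M10 : 0 < M + 1 by rewrite ltr_wpDl.
have e0 : 0 < e by rewrite powR_gt0// divr_gt0.
have ep : e `^ p = n / (M + 1) by rewrite /e -powRrM mulVf ?gt_eqF// powRr1// divr_ge0// ltW.
pose f t := Num.max (fine (g t)) (e * h t).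
have fg0 t : 0 < t -> 0 <= fine (g t) by move=> t0; rewrite fine_ge0// g0.
have fd x y : 0 < x -> x <= y -> f y <= f x.
  move=> x0 xy; have y0 := lt_le_trans x0 xy.
  rewrite ge_max !le_max (ler_pM2l e0) (hd _ _ x0 xy) orbT andbT.
  by rewrite -lee_fin -!gfin// gd.
have Pf : positive_mfun f.
  split; last by move=> t t0; rewrite lt_max mulr_gt0 ?h0 ?orbT.
  by apply/measurable_EFinP; apply: nonincreasing_measurable_fun => x y x0 xy; rewrite lee_fin fd.
have Nf : (\int[nu]_(t in `]0%R, +oo[) (f t `^ p)%:E <= (2 * n)%:E)%E.
  apply: (@le_trans _ _ (\int[nu]_(t in `]0%R, +oo[) (g t `^ p + (e `^ p)%:E * (h t `^ p)%:E))%E).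
    apply: le_integral_pointwise => t; rewrite /= in_itv/= andbT => t0.
    rewrite gfin// poweR_EFin -EFinM -EFinD lee_fin -powRM ?(ltW e0) ?(ltW (h0 _ t0))//.
    rewrite /f; case: (leP (fine (g t))) => _; first by rewrite lerDr powR_ge0.
    by rewrite lerDl powR_ge0.
  have mh : measurable_fun (`]0, +oo[ : set R) (fun t => (h t `^ p)%:E).
    apply/measurable_EFinP.
    apply: (@measurableT_comp _ _ _ _ _ _ (@powR R ^~ p)) => //.
    by apply/measurable_EFinP; apply: nonincreasing_measurable_fun => x y x0 xy; rewrite lee_fin hd.
  rewrite ge0_integralD//; last 4 first.
  - by move=> t _; exact: poweR_ge0.
  - exact: (proj1 (Mplus_poweR p Mg)).
  - by move=> t _; rewrite mule_ge0// lee_fin powR_ge0.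
  - exact: measurable_funeM.
  rewrite ge0_integralZl_EFin ?powR_ge0//; last by move=> t _; rewrite lee_fin powR_ge0.
  rewrite -/N Nn mulrDl mul1r EFinD leeD2l//.
  apply: (le_trans (lee_wpmul2l _ hM)); first by rewrite lee_fin powR_ge0.
  rewrite -EFinM lee_fin ep mulrAC ler_pdivrMr// ler_wpM2l//.
  by rewrite lerDl.
have Nflt : (\int[nu]_(t in `]0%R, +oo[) (f t `^ p)%:E < +oo)%E by rewrite (le_lt_trans Nf)// ltry.
apply: (@le_trans _ _ (rho (qmean f))).
  apply: (proj1 rho_submonotone) => //; first exact: Mplus_qmean.
  move=> t t0; apply: (@le_trans _ _ (f t)%:E); last first.
    by apply: qmean_ge => //; exact: integral_lt_fin.
  by rewrite gfin// lee_fin /f le_max lexx.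
apply: (le_trans (H _ Pf)); rewrite EFinM -muleA lee_wpmul2l ?lee_fin ?(ltW C0)//.
rewrite -poweR_EFin Nn -poweRM ?lee_fin//.
apply: poweR_ler => //; first exact: ltW.
by apply: integral_ge0 => t _; rewrite lee_fin powR_ge0.
Qed.

End means.

(** * The measure v dt *)

Section density.
Import HBNNSimple.
Context d (T : measurableType d) (R : realType) (mu : {measure set T -> \bar R}).
Context (w : T -> R).
Hypothesis mw : measurable_fun setT w.
Hypothesis w0 : forall x, 0 <= w x.

Let m (A : set T) := (\int[mu]_(x in A) (w x)%:E)%E.

Let mwE A : measurable_fun A (EFin \o w).
Proof. by apply/measurable_EFinP; exact: measurable_funTS. Qed.

(** The instance is packed inside the proof since countable additivity depends
on the measurability and positivity of [w]. *)
Lemma density_measure : sigma_finite setT m ->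
  exists nu : {sigma_finite_measure set T -> \bar R},
    forall A, nu A = (\int[mu]_(x in A) (w x)%:E)%E.
Proof.
move=> sm.
have m0 : m set0 = 0%E by exact: integral_set0.
have m_ge0 A : (0 <= m A)%E by apply: integral_ge0 => x _; rewrite lee_fin.
have m_sa : semi_sigma_additive m.
  move=> /= A mA tA mUA; rewrite /m ge0_integral_bigcup//=; last by move=> x _; rewrite lee_fin.
  by apply: is_cvg_ereal_nneg_natsum_cond => n _ _; exact: m_ge0.
pose nu1 : {measure set T -> \bar R} := HB.pack m (isMeasure.Build _ _ _ m m0 m_ge0 m_sa).
have sf : sfinite_measure m by exact: (sfinite_measure_sigma_finite (mu := nu1)).
pose nu : {sigma_finite_measure set T -> \bar R} :=
  HB.pack m (isMeasure.Build _ _ _ m m0 m_ge0 m_sa)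
    (isSFinite.Build _ _ _ m sf) (isSigmaFinite.Build _ _ _ m sm).
by exists nu.
Qed.

(** Both sides are monotone limits of their values on simple functions, for
which the formula is the definition of [nu]. *)
Lemma ge0_integral_density (nu : {measure set T -> \bar R}) :
  (forall A, measurable A -> nu A = (\int[mu]_(x in A) (w x)%:E)%E) ->
  forall E f, measurable E -> measurable_fun E f -> (forall x, E x -> (0 <= f x)%E) ->
  (\int[nu]_(x in E) f x = \int[mu]_(x in E) (f x * (w x)%:E))%E.
Proof.
move=> nuE E f mE mf f0; pose h := nnsfun_approx mE mf.
have hf x : E x -> (h n x)%:E @[n --> \oo] --> f x.
  by move=> Ex; exact: cvg_nnsfun_approx.
have hle x : E x -> {homo (fun n => (h n x)%:E) : a b / (a <= b)%N >-> (a <= b)%E}.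
  by move=> Ex a b ab; rewrite lee_fin; exact/lefP/nd_nnsfun_approx.
have mh n : measurable_fun E (fun x => (h n x)%:E).
  by apply/measurable_EFinP; exact: measurable_funTS.
transitivity (limn (fun n => \int[nu]_(x in E) (h n x)%:E)%E).
  rewrite -monotone_convergence//.
  - by apply: eq_integral => x /[!inE] Ex; apply/esym/cvg_lim => //; exact: hf.
  - by move=> n x Ex; rewrite lee_fin.
transitivity (limn (fun n => \int[mu]_(x in E) ((h n x)%:E * (w x)%:E))%E); last first.
  rewrite -monotone_convergence//.
  - apply: eq_integral => x /[!inE] Ex; apply/cvg_lim => //.
    by apply: cvgeZr => //; exact: hf.
  - by move=> n; exact: emeasurable_funM.
  - by move=> n x Ex; rewrite mule_ge0 ?lee_fin.
  - by move=> x Ex a b ab; rewrite lee_wpmul2r ?lee_fin// -lee_fin hle.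
congr (lim _); apply: congr2 => //; apply/funext => n.
have hE x : (h n x)%:E = (\sum_(y \in range (h n)) (y * \1_(h n @^-1` [set y]) x)%:E)%R.
  by rewrite fsumEFin// -(fimfunE (h n) x).
under eq_integral do rewrite hE.
under [RHS]eq_integral.
  move=> x _; rewrite hE ge0_mule_fsuml; last by move=> y; exact: nnfun_muleindic_ge0.
  over.
have mind k y : measurable_fun E (fun x => (y * \1_(h k @^-1` [set y]) x)%:E).
  by apply: (measurable_comp measurableT) => //; exact: measurable_funM.
rewrite ge0_integral_fsum//; last by move=> y x Ex; exact: nnfun_muleindic_ge0.
rewrite ge0_integral_fsum//; last 2 first.
- by move=> y; exact: emeasurable_funM.
- by move=> y x Ex; rewrite mule_ge0 ?lee_fin// -lee_fin nnfun_muleindic_ge0.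
apply: eq_fsbigr => y; rewrite inE => -[z _ <-].
set A := h n @^-1` _.
have mA : measurable A by exact: measurable_sfunP.
under [RHS]eq_integral do rewrite EFinM -muleA.
under eq_integral do rewrite EFinM.
have m1A : measurable_fun E (fun x => (\1_A x : R)%:E).
  exact/measurable_EFinP/measurable_indic.
rewrite ge0_integralZl ?lee_fin// ge0_integralZl ?lee_fin//; last 2 first.
- exact: emeasurable_funM.
- by move=> x _; rewrite mule_ge0// lee_fin.
congr (_ * _)%E; rewrite integral_indic// nuE; last exact: measurableI.
rewrite [LHS]integral_mkcond [RHS]integral_mkcond; apply: eq_integral => x _.
rewrite !patchE in_setI indicE; case: (x \in E); rewrite ?andbF ?andbT//.
by case: (x \in A); rewrite ?mul1e ?mul0e.
Qed.

Lemma integral_density (nu : {measure set T -> \bar R}) :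
  (forall A, measurable A -> nu A = (\int[mu]_(x in A) (w x)%:E)%E) ->
  forall E f, measurable E -> measurable_fun E f ->
  (\int[nu]_(x in E) f x = \int[mu]_(x in E) (f x * (w x)%:E))%E.
Proof.
move=> nuE E f mE mf; rewrite integralE [RHS]integralE.
rewrite (ge0_integral_density nuE)//; last exact: measurable_funepos.
rewrite (ge0_integral_density nuE)//; last exact: measurable_funeneg.
congr (_ - _)%E; apply: eq_integral => x _; rewrite ?funeposE ?funenegE.
  by rewrite maxe_pMl ?lee_fin// mul0e.
by rewrite maxe_pMl ?lee_fin// mul0e mulNe.
Qed.

End density.

Section weight.
Context (R : realType) (v : R -> \bar R).
Hypothesis v_weight : weight v.
Hypothesis V_fin : forall t : R, 0 < t -> (primitive v t < +oo)%E.
Notation mu := (@lebesgue_measure R).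

Let ae_filter : Filter (nbhs (almost_everywhere mu)).
Proof. exact: (@ae_filter_ringOfSetsType _ _ _ mu). Qed.
#[local] Existing Instance ae_filter.

(** A weight is finite almost everywhere because its primitive is finite. *)
Lemma weight_ae_fin : {ae mu, forall t, 0 < t -> (0 < v t < +oo)%E}.
Proof.
have [mv v0] := v_weight.
have fin n : {ae mu, forall t, `]0, n.+1%:R[%classic t -> v t \is a fin_num}.
  have mvn : measurable_fun (`]0, n.+1%:R[ : set R) v by exact: measurable_funS (@itv0_sub R _) mv.
  apply: integrable_ae => //; apply/integrableP; split => //.
  apply: le_lt_trans (V_fin (ltr0Sn R n)).
  rewrite le_eqVlt; apply/predU1P; left; apply: ae_eq_integral => //.
    exact: measurableT_comp.
  apply: filterS v0 => t v0 /= /[!in_itv]/= /andP[t0 _].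
  by rewrite gee0_abs// ltW// v0.
have : {ae mu, forall t n, `]0, n.+1%:R[%classic t -> v t \is a fin_num}.
  by apply/ae_foralln => n; exact: fin.
apply: filterS2 v0 => t v0 vfin t0; rewrite v0//= ltey_eq.
rewrite (vfin (Num.truncn t))//.
by rewrite /= in_itv/= t0/= truncnS_gt.
Qed.

(** The weight is replaced by an almost everywhere equal function [w] which is
positive and real at every point of (0, oo) and vanishes elsewhere. *)
Lemma weight_density : exists nu : {sigma_finite_measure set (measurableTypeR R) -> \bar R},
  [/\ forall (A : set (measurableTypeR R)) (F : R -> \bar R), measurable A ->
          A `<=` (`]0, +oo[ : set R) -> measurable_fun A F ->
        (\int[nu]_(s in A) F s = \int[mu]_(s in A) (F s * v s))%E,
      forall t, 0 < t -> (nu `]0%R, t[%classic < +oo)%E,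
      forall t, 0 < t -> (0 < nu `]0%R, t[%classic)%E &
      forall t, nu [set t] = 0%E].
Proof.
have [mv _] := v_weight; pose D : set R := `]0, +oo[%classic.
have mD : measurable (D : set (measurableTypeR R)) by exact: measurable_itv.
pose E := D `&` (v @^-1` `]0%E, +oo%E[).
have mE : measurable (E : set (measurableTypeR R)) by apply: mv => //; exact: emeasurable_itv.
pose w t := if t \in E then fine (v t) else \1_D t.
have mw : measurable_fun setT w.
  rewrite (_ : w = fun t => fine ((v \_ E) t) + \1_(D `\` E) t).
    apply: measurable_funD.
      apply: (measurableT_comp (fine_measurable measurableT)).
      apply/(measurable_restrictT _ mE).
      by apply: measurable_funS mv => // t [].
    exact: measurable_indic (measurableD mD mE).
  apply/funext => t; rewrite /w patchE !indicE in_setD.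
  by case: (t \in E); rewrite ?andbF ?andbT/= ?addr0 ?add0r//.
have w0 t : 0 < t -> 0 < w t.
  move=> t0; rewrite /w; case: ifPn => [/[!inE] -[_]|_].
    by rewrite /= in_itv/= => /andP[? ?]; rewrite fine_gt0// ?andbT//; apply/andP.
  by rewrite indicE mem_set ?ltr01//= /D /= in_itv/= t0.
have w_ge0 t : 0 <= w t.
  have [t0|t0] := ltP 0 t; first by rewrite ltW// w0.
  rewrite /w; case: ifPn => [/[!inE] -[]|_]; last by rewrite indicE.
  by rewrite /D /= in_itv/= andbT ltNge t0.
have wv : {ae mu, forall t, 0 < t -> (w t)%:E = v t}.
  apply: filterS weight_ae_fin => t vt t0; have /andP[v0 vy] := vt t0.
  rewrite /w mem_set ?fineK//; first by rewrite ge0_fin_numE// ltW.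
  by split; rewrite /D /= in_itv/= ?t0 ?v0.
have Vw t : (\int[mu]_(s in `]0%R, t[) (w s)%:E = primitive v t)%E.
  apply: ae_eq_integral => //.
  - by apply/measurable_EFinP; exact: measurable_funTS.
  - exact: measurable_funS (@itv0_sub R _) mv.
  - by apply: filterS wv => s ws /= /[!in_itv]/= /andP[s0 _]; exact: ws.
have w_neg s : s <= 0 -> w s = 0.
  move=> s0; have sD : ~ D s by rewrite /D /= in_itv/= andbT; apply/negP; rewrite -leNgt.
  rewrite /w ifN; first by rewrite indicE memNset.
  by apply/negP => /[!inE] -[].
have sfin : sigma_finite setT (fun A => \int[mu]_(x in A) (w x)%:E)%E.
  exists (fun n => `]-oo, n.+1%:R[%classic).
    apply/esym/seteqP; split => // t _; exists (Num.truncn t) => //=.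
    by rewrite in_itv/= truncnS_gt.
  move=> n; split => //; apply: le_lt_trans (V_fin (ltr0Sn R n)); rewrite -Vw.
  rewrite integral_mkcond [leRHS]integral_mkcond; apply: le_integral_pointwise => s _.
  rewrite !patchE !mem_setE !in_itv/=; have [s0|s0] := ltP 0 s; first by [].
  by rewrite w_neg//=; case: ifP.
have [nu nuE] := @density_measure _ (measurableTypeR R) R mu w mw w_ge0 sfin.
exists nu.
have nu0t t : 0 < t -> nu `]0%R, t[%classic = primitive v t by move=> t0; rewrite nuE Vw.
split.
- move=> A F mA AD mF; rewrite (@integral_density _ (measurableTypeR R) R mu w mw w_ge0 nu (fun A _ => nuE A) A F mA mF)//.
  apply: ae_eq_integral => //.
  + apply: emeasurable_funM => //; apply/measurable_EFinP; exact: measurable_funTS.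
  + by apply: emeasurable_funM => //; exact: measurable_funS mv.
  + apply: filterS wv => s ws /AD; rewrite /= in_itv/= andbT => s0.
    by rewrite ws.
- by move=> t t0; rewrite nu0t// V_fin.
- move=> t t0; have mu0 : (0 < mu `]0%R, t[%classic)%E.
    by rewrite lebesgue_measure_itv/= lte_fin t0 oppr0 adde0 lte_fin.
  rewrite nuE; apply: integral_pos => //.
  + by apply/measurable_EFinP; exact: measurable_funTS.
  + by move=> s; rewrite /= in_itv/= => /andP[s0 _]; exact: w0.
- by move=> t; rewrite nuE integral_set1.
Qed.

End weight.

(** * The equivalences in terms of the weight *)

Section translation.
Context (R : realType) (v : R -> \bar R)
  (nu : {sigma_finite_measure set (measurableTypeR R) -> \bar R}).
Notation mu := (@lebesgue_measure R).
Hypothesis dens : forall (A : set (measurableTypeR R)) (F : R -> \bar R),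
  measurable A -> A `<=` (`]0, +oo[ : set R) -> measurable_fun A F ->
  (\int[nu]_(s in A) F s = \int[mu]_(s in A) (F s * v s))%E.
Hypothesis nu_fin : forall t, 0 < t -> (nu `]0%R, t[%classic < +oo)%E.
Hypothesis nu_gt0 : forall t, 0 < t -> (0 < nu `]0%R, t[%classic)%E.
Hypothesis nu_atomless : forall t, nu [set t] = 0%E.
Context (rho : (R -> \bar R) -> \bar R) (p : R).
Hypothesis rho_submonotone : submonotone rho.
Hypothesis p_gt1 : 1 < p.
Notation W := (mass nu).
Implicit Types f g : R -> \bar R.

Let p0 : 0 < p. Proof. exact: lt_trans p_gt1. Qed.

Lemma primitiveE t : primitive v t = (W t)%:E.
Proof.
rewrite -(massE nu_fin) -[RHS]mul1e -(integral_cst nu _ 1%E)// (dens _ (@itv0_sub R t))//.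
by apply: eq_integral => s _; rewrite mul1e.
Qed.

Lemma averageE f t : measurable_fun (`]0, +oo[ : set R) f -> 0 < t ->
  average v f t = navg nu f t.
Proof.
move=> mf t0; have Wt := mass_gt0 nu_fin nu_gt0 t0.
rewrite /average /navg primitiveE inver gt_eqF//.
by rewrite (dens _ (@itv0_sub R t))//; exact: measurable_funS (@itv0_sub R t) mf.
Qed.

Lemma tailE f t : Mplus f -> 0 < t -> tail v f t = ntail nu f t.
Proof.
move=> Mf t0; rewrite /tail /ntail (dens _ (itvy_sub t0))//; last first.
  exact: (Mplus_itv_measurable (MplusM Mf (Mplus_mass nu_fin _)) (itvy_sub t0)).
apply: eq_integral => s; rewrite inE/= in_itv/= andbT => ts.
have Ws := mass_gt0 nu_fin nu_gt0 (lt_trans t0 ts).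
by rewrite primitiveE inver gt_eqF// powR_inv1 ?ltW// (muleC (v s)) muleA.
Qed.

Lemma normE F : measurable_fun (`]0, +oo[ : set R) F ->
  (\int[mu]_(t in `]0%R, +oo[) (F t * v t) = \int[nu]_(t in `]0%R, +oo[) F t)%E.
Proof. by move=> mF; rewrite dens. Qed.

Lemma norm_powE f r e : Mplus f ->
  (\int[mu]_(t in `]0%R, +oo[) (f t `^ r * primitive v t `^ e * v t) =
   \int[nu]_(t in `]0%R, +oo[) (f t `^ r * (W t `^ e)%:E))%E.
Proof.
move=> Mf; rewrite -normE; last exact: (proj1 (MplusM (Mplus_poweR r Mf) (Mplus_mass nu_fin _))).
by apply: eq_integral => t _; rewrite primitiveE poweR_EFin.
Qed.

Lemma norm_realE (f : R -> R) e : positive_mfun f ->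
  (\int[mu]_(t in `]0%R, +oo[) ((f t `^ e)%R%:E * v t) =
   \int[nu]_(t in `]0%R, +oo[) (f t `^ e)%R%:E)%E.
Proof.
by move=> Pf; rewrite normE//; exact: (proj1 (Mplus_poweR e (positive_mfun_Mplus Pf))).
Qed.

Lemma rho_averageE f q e : Mplus f ->
  rho (fun t => average v f t `^ q * primitive v t `^ e)%E =
  rho (fun t => navg nu f t `^ q * (W t `^ e)%:E)%E.
Proof.
move=> Mf; apply/esym; apply: rho_ext => //.
  exact: MplusM (Mplus_poweR _ (Mplus_navg nu_fin nu_gt0 Mf)) (Mplus_mass nu_fin _).
by move=> t t0; rewrite averageE ?primitiveE//; exact: (proj1 Mf).
Qed.

Lemma rho_tailE f q e : Mplus f ->
  rho (fun t => primitive v t `^ e * tail v f t `^ q)%E =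
  rho (fun t => (W t `^ e)%:E * ntail nu f t `^ q)%E.
Proof.
move=> Mf; apply/esym; apply: rho_ext => //.
  exact: MplusM (Mplus_mass nu_fin _) (Mplus_poweR _ (Mplus_ntail _ Mf)).
by move=> t t0; rewrite tailE ?primitiveE.
Qed.

Definition decreasing_bounded := exists2 C : R, 0 < C & decreasing_bound nu rho p C.

(** The exponent (alpha p - beta r) / r plays the role of [gam]; the condition
on alpha, beta and r is the Hardy condition gam < 1 - 1/r. *)
Lemma average_of_decreasing : decreasing_bounded -> forall r alpha beta : R, 1 <= r ->
  alpha * p - beta * r < r - 1 ->
  exists2 C : R, 0 < C & forall f, Mplus f ->
   (rho (fun t => average v f t `^ (r / p)%R * primitive v t `^ (alpha - beta * r / p)%R) <=
    C%:E * (\int[mu]_(t in `]0%R, +oo[)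
              (f t `^ r * primitive v t `^ (alpha * p - beta * r)%R * v t)) `^ p^-1%R)%E.
Proof.
move=> [C C0 decC] r alpha beta r1 abr; have r0 : 0 < r by exact: lt_le_trans r1.
pose gam := (alpha * p - beta * r) / r.
have gam1 : gam < 1 - r^-1.
  by rewrite ltr_pdivrMr// mulrBl mul1r mulVf ?gt_eqF.
have [C' C'0 H] := average_bound nu_fin nu_gt0 nu_atomless rho_submonotone p_gt1 C0 r1 gam1 decC.
exists C' => // f Mf; rewrite (rho_averageE _ _ Mf) (norm_powE _ _ Mf).
have := H f Mf; have -> : gam * r = alpha * p - beta * r by rewrite divfK ?gt_eqF.
have -> // : gam * (r / p) = alpha - beta * r / p.
by rewrite /gam; field; rewrite !gt_eqF.
Qed.

Lemma decreasing_of_average r alpha beta C : 0 < C -> 1 <= r -> alpha * p - beta * r < r - 1 ->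
  (forall f, Mplus f ->
   (rho (fun t => average v f t `^ (r / p)%R * primitive v t `^ (alpha - beta * r / p)%R) <=
    C%:E * (\int[mu]_(t in `]0%R, +oo[)
              (f t `^ r * primitive v t `^ (alpha * p - beta * r)%R * v t)) `^ p^-1%R)%E) ->
  decreasing_bounded.
Proof.
move=> C0 r1 abr H; have r0 : 0 < r by exact: lt_le_trans r1.
pose gam := (alpha * p - beta * r) / r.
have gam1 : gam < 1 by rewrite ltr_pdivrMr// mul1r; lra.
apply: (decreasing_bound_of_average nu_fin nu_gt0 nu_atomless rho_submonotone p_gt1 C0 r1 gam1).
move=> f Mf; have := H f Mf; rewrite (rho_averageE _ _ Mf) (norm_powE _ _ Mf).
have -> : gam * r = alpha * p - beta * r by rewrite divfK ?gt_eqF.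
have -> // : gam * (r / p) = alpha - beta * r / p.
by rewrite /gam; field; rewrite !gt_eqF.
Qed.

(** The plain average inequality is the case r = p, alpha = beta = 0. *)
Lemma plain_averageE f C : Mplus f ->
  (rho (fun t => average v f t `^ (p / p)%R * primitive v t `^ (0 - 0 * p / p)%R) <=
    C%:E * (\int[mu]_(t in `]0%R, +oo[)
              (f t `^ p * primitive v t `^ (0 * p - 0 * p)%R * v t)) `^ p^-1%R)%E =
  (rho (fun t => average v f t) <=
    C%:E * (\int[mu]_(t in `]0%R, +oo[) (f t `^ p * v t)) `^ p^-1%R)%E.
Proof.
move=> Mf; congr (_ <= _ * _ `^ _)%E; last first.
  by apply: eq_integral => t _; rewrite !mul0r subrr poweRe0 mule1.
apply/esym; apply: rho_ext => //.
  apply: (eq_Mplus (Mplus_navg nu_fin nu_gt0 Mf)) => t t0.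
  by rewrite averageE//; exact: (proj1 Mf).
move=> t t0; rewrite !mul0r subrr poweRe0 mule1 divff ?gt_eqF// poweRe1//.
rewrite averageE//; last exact: (proj1 Mf).
exact: (proj2 (Mplus_navg nu_fin nu_gt0 Mf)).
Qed.

Lemma total_massE : (\int[mu]_(t in `]0%R, +oo[) v t = nu `]0%R, +oo[%classic)%E.
Proof.
rewrite -[RHS]mul1e -(integral_cst nu _ 1%E)// dens//.
by apply: eq_integral => s _; rewrite mul1e.
Qed.

Lemma tail_of_decreasing : decreasing_bounded -> forall r alpha : R, 1 <= r -> - p^-1 < alpha ->
  exists C21 C22 : R, [/\ 0 < C21, 0 < C22,
    (forall f, Mplus f ->
      (rho (fun t => primitive v t `^ alpha * tail v f t `^ (r / p)%R) <=
       C21%:E * (\int[mu]_(t in `]0%R, +oo[)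
          (f t `^ r * primitive v t `^ (alpha * p)%R * v t)) `^ p^-1%R)%E) &
    (rho (fun=> 1) <= C22%:E * (\int[mu]_(t in `]0%R, +oo[) v t) `^ p^-1%R)%E].
Proof.
move=> [C C0 decC] r alpha r1 alp; have r0 : 0 < r by exact: lt_le_trans r1.
pose del := alpha * p / r.
have delr : - r^-1 < del.
  rewrite ltr_pdivlMr// mulNr mulVf ?gt_eqF// -ltr_pdivrMr// mulN1r//.
have [C' C'0 H] := tail_bound nu_fin nu_gt0 nu_atomless rho_submonotone p_gt1 C0 r1 delr decC.
exists C', C; split => //.
  move=> f Mf; rewrite (rho_tailE _ _ Mf) (norm_powE _ _ Mf); have := H f Mf.
  have -> : del * r = alpha * p by rewrite divfK ?gt_eqF.
  have -> // : del * (r / p) = alpha.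
  by rewrite /del; field; rewrite !gt_eqF.
have M1 : Mplus (fun _ : R => 1%E) by exact: Mplus_cst.
have := decC _ M1 (fun _ _ _ _ => lexx _); rewrite total_massE.
rewrite (eq_integral (cst 1%E)); last by move=> t _; rewrite poweR1r.
by rewrite integral_cst// mul1e.
Qed.

Lemma decreasing_of_tail r alpha C C1 : 0 < C -> 0 < C1 -> 1 <= r -> - p^-1 < alpha ->
  (forall f, Mplus f ->
      (rho (fun t => primitive v t `^ alpha * tail v f t `^ (r / p)%R) <=
       C%:E * (\int[mu]_(t in `]0%R, +oo[)
          (f t `^ r * primitive v t `^ (alpha * p)%R * v t)) `^ p^-1%R)%E) ->
  (rho (fun=> 1) <= C1%:E * (\int[mu]_(t in `]0%R, +oo[) v t) `^ p^-1%R)%E ->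
  decreasing_bounded.
Proof.
move=> C0 C10 r1 alp H H1; have r0 : 0 < r by exact: lt_le_trans r1.
pose del := alpha * p / r.
have delr : - r^-1 < del.
  by rewrite ltr_pdivlMr// mulNr mulVf ?gt_eqF// -ltr_pdivrMr// mulN1r.
apply: (decreasing_bound_of_tail nu_fin nu_gt0 nu_atomless rho_submonotone p_gt1 C0 C10 r1 delr); last first.
  by rewrite -total_massE.
move=> f Mf; have := H f Mf; rewrite (rho_tailE _ _ Mf) (norm_powE _ _ Mf).
have -> : del * r = alpha * p by rewrite divfK ?gt_eqF.
have -> // : del * (r / p) = alpha.
by rewrite /del; field; rewrite !gt_eqF.
Qed.

(** The means occurring in the theorem agree with a quasi-arithmetic mean as
soon as [f] is integrable on (0, t), which is the case when its norm is finite;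
when the norm is infinite the inequality is trivial. *)
Section mean.
Context (psi : R -> R) (T : (R -> R) -> R -> \bar R).
Hypothesis psiS : supported psi.
Hypothesis TE : forall (f : R -> R) t, positive_mfun f -> 0 < t ->
  (\int[nu]_(s in `]0%R, t[) (f s)%:E < +oo)%E -> T f t = qmean nu psi f t.

Notation mean_inequality C := (forall f : R -> R, positive_mfun f ->
   (rho (T f) <= C%:E * (\int[mu]_(t in `]0%R, +oo[) ((f t `^ p)%R%:E * v t)) `^ p^-1%R)%E).

Let rho_TE (f : R -> R) : positive_mfun f ->
  (\int[nu]_(t in `]0%R, +oo[) (f t `^ p)%R%:E < +oo)%E -> rho (T f) = rho (qmean nu psi f).
Proof.
move=> Pf Nf; apply/esym; apply: rho_ext => //; first exact: Mplus_qmean.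
move=> t t0; rewrite TE//.
exact: integral_lt_fin Nf.
Qed.

Lemma mean_of_decreasing : decreasing_bounded -> exists2 C : R, 0 < C & mean_inequality C.
Proof.
move=> [C C0 decC].
have [C' C'0 H] := qmean_bound nu_fin nu_gt0 nu_atomless rho_submonotone p_gt1 psiS C0 decC.
exists C' => // f Pf; rewrite norm_realE//.
set N := (\int[nu]_(t in _) _)%E.
have [Ny|Nfin] := eqVneq N +oo%E.
  by rewrite Ny poweRyr ?invr_neq0 ?gt_eqF// gt0_muley ?leey// lte_fin.
by rewrite rho_TE ?ltey//; exact: H.
Qed.

Lemma decreasing_of_mean C : 0 < C -> mean_inequality C -> decreasing_bounded.
Proof.
move=> C0 H; apply: (decreasing_bound_of_qmean nu_fin nu_gt0 nu_atomless rho_submonotone p_gt1 psiS C0).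
move=> f Pf; have := H f Pf; rewrite norm_realE//.
set N := (\int[nu]_(t in _) _)%E => HN.
have [Ny|Nfin] := eqVneq N +oo%E.
  by rewrite Ny poweRyr ?invr_neq0 ?gt_eqF// gt0_muley ?leey// lte_fin.
by rewrite -rho_TE ?ltey.
Qed.

End mean.

(** By Jensen's inequality the average of ln f is not +oo; when it is -oo both
sides are 0. *)
Lemma exp_meanE (f : R -> R) t : positive_mfun f -> 0 < t ->
  (\int[nu]_(s in `]0%R, t[) (f s)%:E < +oo)%E ->
  expeR (average v (fun s => (ln (f s))%:E) t) = qmean nu (@ln R) f t.
Proof.
move=> Pf t0 If; rewrite averageE//; last exact: (measurable_psi (ln_supported R) Pf).
have [a [_ _]] := jensen nu_fin nu_gt0 (ln_supported R) Pf t0 If.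
rewrite /qmean; case: (navg _ _ _) => [y _||_]; [|by rewrite leye_eq|by []].
have := einverse_in (ln_supported R) (expR_gt0 y); rewrite expRK => ->.
by [].
Qed.

(** The average of psi o f is - j / V(t) with j the integral of f^(-1/r), and
psi^-1 (- y) = y^-r. Jensen's inequality excludes j = 0, and both sides vanish
when j is infinite. *)
Lemma harmonic_meanE r (f : R -> R) t : 0 < r -> positive_mfun f -> 0 < t ->
  (\int[nu]_(s in `]0%R, t[) (f s)%:E < +oo)%E ->
  ((primitive v t / \int[mu]_(s in `]0%R, t[) ((f s `^ (- r^-1))%:E * v s)) `^ r)%E =
  qmean nu (fun x => - (x `^ (- r^-1))) f t.
Proof.
move=> r0 Pf t0 If; have ri0 : 0 < r^-1 by rewrite invr_gt0.
have psiS := powRN_supported ri0.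
have Wt := mass_gt0 nu_fin nu_gt0 t0.
have [a [a0 _]] := jensen nu_fin nu_gt0 psiS Pf t0 If.
have Mg : Mplus (fun s => (f s `^ (- r^-1))%:E).
  exact: (Mplus_poweR (- r^-1) (positive_mfun_Mplus Pf)).
rewrite /qmean /navg -(dens _ (@itv0_sub R t))//; last exact: measurable_funS (@itv0_sub R t) (proj1 Mg).
under eq_integral do rewrite EFinN.
rewrite integral_ge0N; last by move=> s _; rewrite lee_fin powR_ge0.
rewrite primitiveE.
have : (0 <= \int[nu]_(s in `]0%R, t[) (f s `^ (- r^-1))%:E)%E.
  by apply: integral_ge0 => s _; rewrite lee_fin powR_ge0.
case: (\int[nu]_(s in `]0%R, t[) _)%E => [j| |]//.
  rewrite lee_fin -EFinN -EFinM lee_fin => j0 ja.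
  have {}j0 : 0 < j.
    rewrite lt_neqAle eq_sym j0 andbT; apply/eqP => j_eq0.
    by move: ja; rewrite j_eq0 oppr0 mulr0 lerNr oppr0 leNgt powR_gt0.
  have x0 : 0 < (j / W t) `^ (- r) by rewrite powR_gt0// divr_gt0.
  have := einverse_in psiS x0.
  rewrite -powRrM mulrNN divff ?gt_eqF// powRr1 ?divr_ge0 ?(ltW j0) ?(ltW Wt)//.
  rewrite mulrN (mulrC j) => ->.
  rewrite inver gt_eqF// -EFinM poweR_EFin; congr (_%:E).
  rewrite powRN -powR_inv1 ?powR_ge0// -powRrM mulrN1 mulrC.
  rewrite -[W t / j]invrK -powR_inv1 ?invr_ge0 ?divr_ge0 ?(ltW j0) ?(ltW Wt)//.
  by rewrite -powRrM mulN1r invf_div mulrC.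
by move=> _ _; rewrite invey mule0 poweR0r ?gt_eqF// mulrNy gtr0_sg ?invr_gt0// mul1e.
Qed.

(** The supporting line at 1 bounds the positive part of psi o f by an
integrable function. *)
Lemma psi_pos_fin psi (f : R -> R) t : supported psi -> positive_mfun f -> 0 < t ->
  (\int[nu]_(s in `]0%R, t[) (f s)%:E < +oo)%E ->
  (\int[nu]_(s in `]0%R, t[) (fun s => (psi (f s))%:E)^\+ s < +oo)%E.
Proof.
move=> psiS Pf t0 If; have [mf f0] := Pf.
have [c c0 Hc] := proj1 psiS _ ltr01.
apply: (@le_lt_trans _ _ (\int[nu]_(s in `]0%R, t[) (`|psi 1|%:E + c%:E * (f s)%:E))%E).
  apply: le_integral_pointwise => s; rewrite /= in_itv/= => /andP[s0 _].
  rewrite funeposE ge_max -EFinM -EFinD !lee_fin.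
  rewrite addr_ge0 ?mulr_ge0 ?(ltW (f0 _ s0))// andbT.
  apply: (le_trans (Hc _ (f0 _ s0))).
  by have := ler_norm (psi 1); rewrite mulrBr mulr1; lra.
have mft : measurable_fun (`]0, t[ : set R) (fun s => (f s)%:E).
  exact: measurable_funS (@itv0_sub R t) (proj1 (positive_mfun_Mplus Pf)).
have f0t s : `]0, t[%classic s -> (0 <= (f s)%:E)%E.
  by rewrite /= in_itv/= => /andP[s0 _]; rewrite lee_fin ltW// f0.
rewrite ge0_integralD//; last 2 first.
- by move=> s st; apply: mule_ge0; [rewrite lee_fin|exact: f0t].
- exact: measurable_funeM.
rewrite (integral_cst nu _ `|psi 1|%:E)// (massE nu_fin) ge0_integralZl_EFin//.
by rewrite lte_add_pinfty ?ltry// lte_mul_pinfty.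
Qed.

Lemma einverse_opp (phi : R -> R) (y : R) : supported (\- phi) ->
  einverse phi y%:E = einverse (\- phi) (- y)%:E.
Proof.
move=> phiS; have [[x x0 <-]|H] := pselect (exists2 x, 0 < x & phi x = y).
  rewrite (einverse_in phiS x0) /einverse pinvKV//; last by rewrite inE/= in_itv/= x0.
  move=> a b; rewrite !inE/= !in_itv/= !andbT => a0 b0 ab.
  apply/eqP; rewrite eq_le -(supported_le phiS a0 b0) -(supported_le phiS b0 a0)/=.
  by rewrite ab lexx.
rewrite !einverse_notin// => -[x x0 xy]; apply: H; exists x => //.
exact: oppr_inj.
Qed.

(** Passing from phi to - phi changes the sign of the average provided that the
positive and negative parts of phi o f do not both have infinite integral. *)
Lemma opp_meanE (phi : R -> R) (f : R -> R) t : supported (\- phi) -> positive_mfun f -> 0 < t ->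
  (\int[nu]_(s in `]0%R, t[) (f s)%:E < +oo)%E ->
  einverse phi (average v (fun s => (phi (f s))%:E) t) = qmean nu (\- phi) f t.
Proof.
move=> phiS Pf t0 If.
have mphi : measurable_fun (`]0, +oo[ : set R) (fun s => (phi (f s))%:E).
  have /measurable_EFinP := measurable_psi phiS Pf => mf.
  apply/measurable_EFinP; rewrite (_ : (fun s => phi (f s)) = \- (fun s => - phi (f s))).
    exact: measurable_funN.
  by apply/funext => s /=; rewrite opprK.
rewrite averageE// /qmean /navg/=.
have := psi_pos_fin phiS Pf t0 If.
rewrite (_ : (fun s => ((\- phi) (f s))%:E) = \- (fun s => (phi (f s))%:E))%E; last first.
  by apply/funext => s /=; rewrite EFinN.
rewrite funeposN => negfin.
rewrite integralN; last first.
  by rewrite fin_num_adde_defl// fin_numN ge0_fin_numE//; apply: integral_ge0 => s _; exact: funeneg_ge0.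
rewrite muleN; case: (_^-1%:E * _)%E => [y| |]//.
by rewrite einverse_opp// EFinN.
Qed.

End translation.

Lemma positive_mfun_powR (R : realType) (f : R -> R) e :
  positive_mfun f -> positive_mfun (fun t => f t `^ e).
Proof.
move=> [mf f0]; split; last by move=> t t0; rewrite powR_gt0// f0.
exact: (@measurableT_comp _ _ _ _ _ _ (@powR R ^~ e)).
Qed.

Theorem theorem1p1 (R : realType) (rho : (R -> \bar R) -> \bar R)
    (p : R) (v : R -> \bar R) (phi : R -> R)
    (rho_ge0 : forall f, Mplus f -> (0 <= rho f)%E)
    (rho_submonotone : submonotone rho)
    (p_gt1 : 1 < p)
    (v_weight : weight v)
    (V_fin : forall t : R, 0 < t -> (primitive v t < +oo)%E)
    (phi_admissible : admissible phi) :
  let mu := @lebesgue_measure R in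
  let V := primitive v in
  [<-> (* (i) *)
   exists2 C1 : R, 0 < C1 &
     forall f : R -> \bar R, Mplus f ->
       (rho (fun t => average v f t) <=
        C1%:E * (\int[mu]_(t in `]0%R, +oo[) (f t `^ p * v t)) `^ p^-1%R)%E
   ; (* (ii) *)
   forall r alpha : R, 1 <= r ->
     Num.max (- p^-1) (- inv_conj p) < alpha ->
     exists C21 C22 : R,
     [/\ 0 < C21, 0 < C22,
       (forall f : R -> \bar R, Mplus f ->
         (rho (fun t => V t `^ alpha * tail v f t `^ (r / p)%R) <=
          C21%:E * (\int[mu]_(t in `]0%R, +oo[)
                      (f t `^ r * V t `^ (alpha * p)%R * v t)) `^ p^-1%R)%E) &
       (rho (fun=> 1) <=
        C22%:E * (\int[mu]_(t in `]0%R, +oo[) v t) `^ p^-1%R)%E]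
   ; (* (iii) *)
   exists r alpha C3 C22 : R,
     [/\ 1 <= r, Num.max (- p^-1) (- inv_conj p) < alpha &
     [/\ 0 < C3, 0 < C22,
       (forall f : R -> \bar R, Mplus f ->
         (rho (fun t => V t `^ alpha * tail v f t `^ (r / p)%R) <=
          C3%:E * (\int[mu]_(t in `]0%R, +oo[)
                     (f t `^ r * V t `^ (alpha * p)%R * v t)) `^ p^-1%R)%E) &
       (rho (fun=> 1) <=
        C22%:E * (\int[mu]_(t in `]0%R, +oo[) v t) `^ p^-1%R)%E]]
   ; (* (iv) *)
   forall r alpha beta : R, 1 <= r ->
     Num.max (- p^-1) (- inv_conj p) < alpha ->
     - inv_conj r < beta ->
     alpha * p - beta * r < r - 1 ->
     exists2 C4 : R, 0 < C4 &
       forall f : R -> \bar R, Mplus f ->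
         (rho (fun t =>
            average v f t `^ (r / p)%R * V t `^ (alpha - beta * r / p)%R) <=
          C4%:E * (\int[mu]_(t in `]0%R, +oo[)
                     (f t `^ r * V t `^ (alpha * p - beta * r)%R * v t))
                  `^ p^-1%R)%E
   ; (* (v) *)
   exists r alpha beta C5 : R,
     [/\ 1 <= r, Num.max (- p^-1) (- inv_conj p) < alpha,
         - inv_conj r < beta, alpha * p - beta * r < r - 1 &
     0 < C5 /\
       forall f : R -> \bar R, Mplus f ->
         (rho (fun t =>
            average v f t `^ (r / p)%R * V t `^ (alpha - beta * r / p)%R) <=
          C5%:E * (\int[mu]_(t in `]0%R, +oo[)
                     (f t `^ r * V t `^ (alpha * p - beta * r)%R * v t))
                  `^ p^-1%R)%E]
   ; (* (vi) *)
   exists2 C6 : R, 0 < C6 &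
     forall f : R -> R, positive_mfun f ->
       (rho (fun t => expeR (average v (fun s => (ln (f s))%:E) t)) <=
        C6%:E * (\int[mu]_(t in `]0%R, +oo[) ((f t `^ p)%R%:E * v t)) `^ p^-1%R)%E
   ; (* (vii) *)
   forall r : R, 0 < r ->
     exists2 C7 : R, 0 < C7 &
       forall f : R -> R, positive_mfun f ->
         (rho (fun t =>
            (V t / \int[mu]_(s in `]0%R, t[) ((f s)^-1%R%:E * v s)) `^ r) <=
          C7%:E * (\int[mu]_(t in `]0%R, +oo[) ((f t `^ (r * p))%R%:E * v t))
                  `^ p^-1%R)%E
   ; (* (viii) *)
   exists r C8 : R,
     [/\ 0 < r, 0 < C8 &
       forall f : R -> R, positive_mfun f ->
         (rho (fun t =>
            (V t / \int[mu]_(s in `]0%R, t[) ((f s)^-1%R%:E * v s)) `^ r) <=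
          C8%:E * (\int[mu]_(t in `]0%R, +oo[) ((f t `^ (r * p))%R%:E * v t))
                  `^ p^-1%R)%E]
   ; (* (ix) *)
   exists2 C9 : R, 0 < C9 &
     forall f : R -> R, positive_mfun f ->
       (rho (fun t =>
          einverse phi (average v (fun s => (phi (f s))%:E) t)) <=
        C9%:E * (\int[mu]_(t in `]0%R, +oo[) ((f t `^ p)%R%:E * v t)) `^ p^-1%R)%E].
Proof.
move=> mu V.
have p0 : 0 < p by exact: lt_trans p_gt1.
have p1 : 1 <= p by exact: ltW.
have gtmax (alpha : R) : Num.max (- p^-1) (- inv_conj p) < alpha -> - p^-1 < alpha.
  by rewrite gt_max => /andP[].
have max_lt0 : Num.max (- p^-1) (- inv_conj p) < 0.
  by rewrite gt_max !oppr_lt0 invr_gt0 p0 /inv_conj subr_gt0 invf_lt1.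
have [nu [dens nu_fin nu_gt0 nu_atomless]] := weight_density v_weight V_fin.
have plain := plain_averageE dens nu_fin nu_gt0 rho_submonotone p_gt1.
have to_average := average_of_decreasing dens nu_fin nu_gt0 nu_atomless rho_submonotone p_gt1.
have of_average := decreasing_of_average dens nu_fin nu_gt0 nu_atomless rho_submonotone p_gt1.
have to_tail := tail_of_decreasing dens nu_fin nu_gt0 nu_atomless rho_submonotone p_gt1.
have of_tail := decreasing_of_tail dens nu_fin nu_gt0 nu_atomless rho_submonotone p_gt1.
have to_mean := mean_of_decreasing dens nu_fin nu_gt0 nu_atomless rho_submonotone p_gt1.
have of_mean := decreasing_of_mean dens nu_fin nu_gt0 nu_atomless rho_submonotone p_gt1.
have expE := exp_meanE dens nu_fin nu_gt0.
(* the harmonic inequality for f is the one below for F = f^r *)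
pose harm (r : R) (F : R -> R) t :=
  ((V t / \int[mu]_(s in `]0%R, t[) ((F s `^ (- r^-1))%:E * v s)) `^ r)%E.
have harmE r (r0 : 0 < r) (f : R -> R) t : positive_mfun f -> 0 < t -> _ -> harm r f t = _ :=
  @harmonic_meanE _ _ _ dens nu_fin nu_gt0 r f t r0.
have harmS r (r0 : 0 < r) : supported (fun x : R => - (x `^ (- r^-1))).
  by apply: powRN_supported; rewrite invr_gt0.
have to_harm r : 0 < r -> decreasing_bounded nu rho p -> exists2 C7 : R, 0 < C7 &
   forall f : R -> R, positive_mfun f ->
     (rho (fun t => (V t / \int[mu]_(s in `]0%R, t[) ((f s)^-1%R%:E * v s)) `^ r) <=
      C7%:E * (\int[mu]_(t in `]0%R, +oo[) ((f t `^ (r * p))%R%:E * v t)) `^ p^-1%R)%E.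
  move=> r0 /(to_mean _ _ (harmS r r0) (harmE r r0))[C C0 HC]; exists C => // f Pf.
  have := HC _ (positive_mfun_powR r Pf).
  rewrite (_ : harm r _ = fun t =>
      ((V t / \int[mu]_(s in `]0%R, t[) ((f s)^-1%R%:E * v s)) `^ r)%E); last first.
    apply/funext => t; rewrite /harm; congr ((_ * inve _) `^ _)%E.
    apply: eq_integral => s; rewrite inE/= in_itv/= => /andP[s0 _].
    by rewrite -powRrM mulrN divff ?gt_eqF// powR_inv1// ltW// (proj2 Pf).
  by under eq_integral do rewrite -powRrM.
have of_harm r C : 0 < r -> 0 < C -> (forall f : R -> R, positive_mfun f ->
     (rho (fun t => (V t / \int[mu]_(s in `]0%R, t[) ((f s)^-1%R%:E * v s)) `^ r) <=
      C%:E * (\int[mu]_(t in `]0%R, +oo[) ((f t `^ (r * p))%R%:E * v t)) `^ p^-1%R)%E) ->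
   decreasing_bounded nu rho p.
  move=> r0 C0 H; apply: (of_mean _ _ (harmS r r0) (harmE r r0) C C0) => F PF.
  have := H _ (positive_mfun_powR r^-1 PF).
  rewrite (_ : (fun t => _) = harm r F); last first.
    by apply/funext => t; rewrite /harm; under eq_integral do rewrite -powRN.
  under eq_integral do rewrite -powRrM mulrA mulVf ?gt_eqF// mul1r.
  by [].
tfae.
- move=> [C C0 H] r alpha r1 /gtmax alp; apply: to_tail => //.
  apply: (of_average p 0 0 C) => //; first by rewrite !mul0r subrr subr_gt0.
  by move=> f Mf; rewrite plain// H.
- move=> H; have [C21 [C22 [C210 C220 H1 H2]]] := H 1 0 (lexx _) max_lt0.
  by exists 1, 0, C21, C22; split.
- move=> [r [alpha [C3 [C22 [r1 /gtmax alp [C30 C220 H1 H2]]]]]] r' alpha' beta' r'1 _ _ ab.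
  apply: to_average => //; exact: (of_tail r alpha C3 C22).
- move=> H; have [||C C0 HC] := H 1 0 1 (lexx _) max_lt0.
  + by rewrite /inv_conj invr1 subrr oppr0.
  + by rewrite mul0r sub0r mulr1 subrr oppr_lt0.
  exists 1, 0, 1, C; split => //.
  + by rewrite /inv_conj invr1 subrr oppr0.
  + by rewrite mul0r sub0r mulr1 subrr oppr_lt0.
- move=> [r [alpha [beta [C5 [r1 _ _ ab [C50 H]]]]]].
  apply: (to_mean _ _ (ln_supported R) expE); exact: (of_average r alpha beta C5).
- move=> [C C0 H] r r0; apply: to_harm => //.
  exact: (of_mean _ _ (ln_supported R) expE C C0 H).
- by move=> /(_ 1 ltr01)[C C0 H]; exists 1, C; split.
- move=> [r [C [r0 C0 H]]]; have h := of_harm r C r0 C0 H.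
  have [phiS|phiS] := admissible_supported phi_admissible.
    apply: (to_mean _ _ phiS) => // f t Pf t0 _.
    by rewrite (averageE dens nu_fin nu_gt0)//; exact: measurable_psi.
  apply: (to_mean _ _ phiS) => // f t Pf t0 If.
  exact: (opp_meanE dens nu_fin nu_gt0).
- move=> [C C0 H].
  have h : decreasing_bounded nu rho p.
    have [phiS|phiS] := admissible_supported phi_admissible.
      apply: (of_mean _ _ phiS _ C C0 H) => f t Pf t0 _.
      by rewrite (averageE dens nu_fin nu_gt0)//; exact: measurable_psi.
    apply: (of_mean _ _ phiS _ C C0 H) => f t Pf t0 If.
    exact: (opp_meanE dens nu_fin nu_gt0).
  have [|C' C'0 H'] := to_average h p 0 0 p1.
    by rewrite !mul0r subrr subr_gt0.
  by exists C' => // f Mf; rewrite -plain// H'.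
Qed.
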